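(* For each $c>c^*$, the system $$\begin{cases}\displaystyle\rho(\xi+c)=\int_{\mathbb R}\frac{(1+d_1)\rho(\xi-y)}{1+d_1\big(\rho(\xi-y)+b_1\rho(\xi-y-c)+a_1\varrho(\xi-y)\big)}k_1(y)\,dy,\\[2mm] \displaystyle\varrho(\xi+c)=\int_{\mathbb R}\frac{(1+d_2)\varrho(\xi-y)}{1+d_2\big(\varrho(\xi-y)+b_2\varrho(\xi-y-c)+a_2\rho(\xi-y)\big)}k_2(y)\,dy,\end{cases}\qquad \xi\in\mathbb R,$$ has a positive solution $(\rho(\xi),\varrho(\xi))$ satisfying $$0<\rho(\xi)<1,\qquad 0<\varrho(\xi)<1,\qquad \xi\in\mathbb R.$$
   Context: Solutions are bounded uniformly continuous functions $\mathbb R\to\mathbb R^2$. All parameters $a_1,a_2,b_1,b_2,d_1,d_2$ are nonnegative, and $d_1>0$, $d_2>0$, $1+b_1>a_2$, $1+b_2>a_1$. For $i=1,2$, the kernel $k_i:\mathbb R\to[0,\infty)$ is Lebesgue measurable and integrable, even ($k_i(x)=k_i(-x)$), with $\int_{\mathbb R}k_i(y)\,dy=1$ and $\int_{\mathbb R}k_i(y)e^{\lambda y}dy<\infty$ for every $\lambda\ge0$. Define $$c^*=\max_{i=1,2}\ \inf_{\lambda>0}\frac{\ln\left((1+d_i)\int_{\mathbb R}e^{\lambda y}k_i(y)\,dy\right)}{\lambda}.$$ *)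

(* Defs.v *)
From HB Require Import structures.
From mathcomp Require Import all_boot all_order all_algebra.
From mathcomp Require Import all_classical all_reals all_analysis.

Set Implicit Arguments.
Unset Strict Implicit.
Unset Printing Implicit Defensive.
Import Order.TTheory GRing.Theory Num.Theory.
Import numFieldNormedType.Exports.

Local Open Scope classical_set_scope.
Local Open Scope ring_scope.

(* [completed_lebesgue_measure] lives on the sigma-algebra of Lebesgue (not
   only Borel) measurable sets, so kernels need not be Borel functions;
   [integrable] includes Lebesgue measurability. *)
Definition dispersal_kernel (R : realType) (k : R -> R) : Prop :=
  [/\ forall x, 0 <= k x,
      completed_lebesgue_measure.-integrable setT (EFin \o k),
      forall x, k (- x) = k x,
      (\int[completed_lebesgue_measure]_y (k y)%:E = 1)%E
    & forall lambda : R, 0 <= lambda ->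
        (\int[completed_lebesgue_measure]_y
           (k y * expR (lambda * y))%:E < +oo)%E].

(* For a dispersal kernel and d > 0 the set below is nonempty and bounded
   below by 0 (evenness gives \int e^{lambda y} k(y) dy >= 1), so [inf] is
   the actual infimum. *)
Definition linear_speed (R : realType) (d : R) (k : R -> R) : R :=
  inf [set s : R | exists2 lambda : R, 0 < lambda &
    s = ln ((1 + d) * \int[completed_lebesgue_measure]_y
                        (expR (lambda * y) * k y)) / lambda].

Definition c_star (R : realType) (d1 d2 : R) (k1 k2 : R -> R) : R :=
  Num.max (linear_speed d1 k1) (linear_speed d2 k2).

Definition bounded_unif_continuous (R : realType) (u : R -> R * R) : Prop :=
  bounded_fun u /\ unif_continuous u.

(* One component of the wave system: [u] is the profile of the species itself
   and [v] that of its competitor. *)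
Definition wave_equation (R : realType) (c d b a : R) (k u v : R -> R) : Prop :=
  forall xi : R,
    u (xi + c) =
    \int[completed_lebesgue_measure]_y
      ((1 + d) * u (xi - y) /
         (1 + d * (u (xi - y) + b * u (xi - y - c) + a * v (xi - y))) * k y).

(* Main.v *)
Require Import Defs.
From HB Require Import structures.
From mathcomp Require Import all_boot all_order all_algebra.
From mathcomp Require Import all_classical all_reals all_analysis.
From mathcomp Require Import measurable_realfun ring lra.
Import Order.TTheory GRing.Theory Num.Theory.
Import numFieldNormedType.Exports.
Local Open Scope classical_set_scope.
Local Open Scope ring_scope.

Set Implicit Arguments.
Unset Strict Implicit.
Unset Printing Implicit Defensive.

(** A solution of the system is a fixed point of the operator [wave_map], which
    sends a pair of profiles to the pair of right-hand sides shifted by [c]. A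
    constant pair is not enough: when species [i] feels neither its own delayed
    density nor its competitor ([b_i = a_i = 0]), its constant value is 1, which
    the theorem excludes. The profiles built here vanish at [-oo] instead, and
    this treats all parameters at once.

    Since [c > c^*], each linearized equation has an exponential solution
    [e^(lam_i x)], where [lam_i] is the last root of
    [(1 + d_i) M_i(l) = e^(l c)] before a point where the left side is the
    smaller one, [M_i] being the moment generating function of the kernel
    ([last_characteristic_root]). The growth law lies below its linearization,
    so [wave_map] keeps profiles below [min(1, e^(lam_i x))]; it lies above the
    linearization minus a quadratic term, and the strict inequality just after
    [lam_i] absorbs that term, so [wave_map] also keeps profiles above
    [max(0, e^(lam_i x) - q e^((lam_i + eps) x))] for large [q]
    ([wave_map_le_up], [wave_map_ge_lo]).

    The operator is not monotone, because the delayed and the competing density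
    act negatively; so the fixed point in this band comes from a Schauder
    argument ([band_fixed_point]). Values of the operator are equicontinuous
    because translation is continuous in L^1 ([convolution_equicontinuous]), and
    the operator is continuous for locally uniform convergence because the tails
    of the kernels are small. Profiles interpolated from finitely many values
    reduce the problem to approximate fixed points on a finite-dimensional cube
    ([approx_brouwer]), and Tychonoff's theorem gives a limit. The
    finite-dimensional statement follows from a combinatorial lemma on labelled
    grids ([cubical_kuhn]), proved by a discrete Stokes formula over [F_2].

    The band gives [0 < u < 1] only far to the left. An even kernel has mass on
    the half-line [y >= 0], so the value at [x] averages strictly admissible
    values from the left of [x - c]; since [c > 0], the strict bounds propagate to
    the right by steps of [c] ([exists_wave]). *)

(** * Labelled grids: a cubical Sperner lemma *)

Section Kuhn.
Variables (J : finType) (L : J -> (J -> nat) -> bool).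

Definition upd (q : J -> nat) (a : J) (t : nat) : J -> nat :=
  fun x => if x == a then t else q x.

Definition step (q : J -> nat) (a : J) : J -> nat := upd q a (q a).+1.

Definition label (a : J) (q : J -> nat) : 'F_2 := (L a q)%:R.

(** The value, on the unit cube with corner [q] and edge directions [A], of the
    cup product of the coboundaries of the labels listed in [s]. Unfolding the
    recursion, when [s] has as many entries as [A], gives a sum over the
    orderings of [A], that is over the monotone edge paths from [q] to the
    opposite corner, each weighted by the product of the increments of the
    successive labels along it. Signs are irrelevant over [F_2]. *)
Fixpoint cup (s : seq J) (A : {set J}) (q : J -> nat) : 'F_2 :=
  if s is j :: s' then
    \sum_(a in A) (label j (step q a) + label j q) * cup s' (A :\ a) (step q a)
  else 1.

Lemma addFF (x : 'F_2) : x + x = 0.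
Proof. by rewrite addrr_pchar2 ?pchar_Fp. Qed.

Lemma step_comm q a b : a != b -> step (step q a) b = step (step q b) a.
Proof.
move=> ab; apply/funext => x; rewrite /step /upd.
rewrite [b == a]eq_sym (negbTE ab); case: (eqVneq x b) => // ->.
by rewrite eq_sym (negbTE ab).
Qed.

Lemma setD1C (A : {set J}) a b : A :\ a :\ b = A :\ b :\ a.
Proof. by rewrite !finset.setDDl finset.setUC. Qed.

Lemma sum_pair_swap (A : {set J}) (X : J -> J -> 'F_2) :
  \sum_(a in A) \sum_(b in A :\ a) X a b =
  \sum_(a in A) \sum_(b in A :\ a) X b a.
Proof.
rewrite (exchange_big_dep [in A]) /=; last by move=> a b _ /setD1P[].
apply: eq_bigr => b bA; apply: eq_bigl => a.
by rewrite !inE eq_sym bA andbT andbC.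
Qed.

Lemma sum_pair_sym0 (A : {set J}) (X : J -> J -> 'F_2) :
  (forall a b, a != b -> X a b = X b a) ->
  \sum_(a in A) \sum_(b in A :\ a) X a b = 0.
Proof.
move=> Xsym; elim: {A}#|A| {-2}A (erefl #|A|) => [|n IH] A.
  by move/eqP; rewrite cards_eq0 => /eqP ->; rewrite big_set0.
move=> cA; have /finset.set0Pn[a aA] : A != finset.set0 by rewrite -card_gt0 cA.
rewrite (big_setD1 a)//=.
have -> : \sum_(i in A :\ a) \sum_(b in A :\ i) X i b =
  \sum_(i in A :\ a) X i a + \sum_(i in A :\ a) \sum_(b in A :\ a :\ i) X i b.
  rewrite -big_split; apply: eq_bigr => i /setD1P[ia iA] /=.
  by rewrite (big_setD1 a) ?inE 1?eq_sym ?ia//= setD1C.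
rewrite IH; last by move: cA; rewrite (cardsD1 a) aA => -[].
rewrite addr0 -big_split big1// => b /setD1P[ba _] /=.
by rewrite Xsym 1?eq_sym// addFF.
Qed.

(** A cup product of coboundaries is a cocycle: its values on the faces of a cube
    add up to 0. After expanding once, every term symmetric in the two
    directions removed cancels against its transpose; the other terms match by
    the induction hypothesis applied in the faces [A :\ a]. *)
Lemma cup_closed s (A : {set J}) q :
  \sum_(a in A) cup s (A :\ a) (step q a) = \sum_(a in A) cup s (A :\ a) q.
Proof.
elim: s A q => [//|j s IH] A q /=.
transitivity (\sum_(a in A) \sum_(b in A :\ a)
    label j (step q a) * cup s (A :\ a :\ b) (step q a)).
  transitivity (\sum_(a in A) \sum_(b in A :\ a)
    label j (step (step q a) b) * cup s (A :\ a :\ b) (step (step q a) b) +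
   \sum_(a in A) \sum_(b in A :\ a)
    label j (step q a) * cup s (A :\ a :\ b) (step (step q a) b)).
    rewrite -big_split; apply: eq_bigr => a _ /=; rewrite -big_split.
    by apply: eq_bigr => b _; rewrite mulrDl.
  rewrite sum_pair_sym0 ?add0r; last by move=> a b ab; rewrite step_comm// setD1C.
  by apply: eq_bigr => a _; rewrite -!big_distrr/= IH.
apply/esym.
transitivity (\sum_(a in A) \sum_(b in A :\ a)
    label j (step q b) * cup s (A :\ a :\ b) (step q b) +
   \sum_(a in A) \sum_(b in A :\ a)
    label j q * cup s (A :\ a :\ b) (step q b)).
  rewrite -big_split; apply: eq_bigr => a _ /=; rewrite -big_split.
  by apply: eq_bigr => b _; rewrite mulrDl.
rewrite [X in _ + X](_ : _ = 0) ?addr0; last first.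
  under eq_bigr => a _ do rewrite -big_distrr/= IH.
  rewrite -big_distrr/= sum_pair_sym0 ?mulr0// => a b ab.
  by rewrite setD1C.
by rewrite sum_pair_swap; apply: eq_bigr => a _; apply: eq_bigr => b _; rewrite setD1C.
Qed.

(** Since [cup s] is closed, the product of [cup s] with the coboundary of label
    [j] is the coboundary of the product [label j * cup s]. *)
Lemma cup_divergence j s (A : {set J}) q : cup (j :: s) A q =
  \sum_(a in A) (label j (step q a) * cup s (A :\ a) (step q a) +
                 label j q * cup s (A :\ a) q).
Proof.
rewrite [RHS]big_split/= -[X in _ + X]big_distrr/= -cup_closed big_distrr -big_split /=.
by apply: eq_bigr => a _; rewrite mulrDl.
Qed.

(** A nonzero sum has a nonzero term, and along the corresponding path each
    label of [s] changes at its own step. *)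
Lemma cup_neq0 s (A : {set J}) q : cup s A q != 0 -> forall j, j \in s ->
  exists r r', [/\ forall x, (q x <= r x <= q x + (x \in A))%N,
                   forall x, (q x <= r' x <= q x + (x \in A))%N
                 & L j r != L j r'].
Proof.
elim: s A q => [//|i s IH] A q /= n0 j.
have [a aA] : exists2 a, a \in A &
    (label i (step q a) + label i q) * cup s (A :\ a) (step q a) != 0.
  apply/exists_inP; apply: contraNT n0; rewrite negb_exists_in => /forall_inP h.
  by rewrite big1// => a /h /negPn/eqP.
rewrite mulf_eq0 => /norP[li c0].
have stepb x : (q x <= step q a x <= q x + (x \in A))%N.
  rewrite /step /upd; case: (eqVneq x a) => [->|_]; last by rewrite leqnn leq_addr.
  by rewrite aA addn1 leqnSn leqnn.
rewrite inE => /predU1P[->|js].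
  exists (step q a), q; split => //; first by move=> x; rewrite leqnn leq_addr.
  by apply: contraNneq li => e; rewrite /label e addFF.
have bnd r : (forall x, step q a x <= r x <= step q a x + (x \in A :\ a))%N ->
    forall x, (q x <= r x <= q x + (x \in A))%N.
  move=> h x; have /andP[h1 h2] := h x; have /andP[h3 h4] := stepb x.
  rewrite (leq_trans h3 h1)/= (leq_trans h2)//.
  rewrite /step /upd !inE; case: (eqVneq x a) => [->|_] //=.
  by rewrite aA addn0 addn1.
have [r [r' [h1 h2 h3]]] := IH _ _ c0 j js.
by exists r, r'; split => //; apply: bnd.
Qed.

Variable m : nat.
Hypothesis L0 : forall a q, q a = 0%N -> L a q = false.
Hypothesis Lm : forall a q, q a = m -> L a q = true.

(** On a face where coordinate [a] is extremal, label [a] is constant, so its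
    coboundary vanishes there. *)
Lemma cup_face s (A : {set J}) q a : a \in s -> a \notin A -> q a = 0%N \/ q a = m ->
  cup s A q = 0.
Proof.
elim: s A q => [//|j s IH] A q + aA qa /=.
have ne b : b \in A -> a != b by move=> bA; apply: contraNneq aA => ->.
have stepa b : b \in A -> step q b a = q a.
  by move=> bA; rewrite /step /upd (negbTE (ne _ bA)).
rewrite inE => /predU1P[<-|js]; rewrite big1// => b bA.
  suff -> : label a (step q b) = label a q by rewrite addFF mul0r.
  rewrite /label; case: qa => qa.
    by rewrite !L0// stepa.
  by rewrite !Lm// stepa.
by rewrite IH ?mulr0 ?stepa// inE (negbTE aA) andbF.
Qed.

(** Sum over the box [0, m)^s, the coordinates outside [s] being those of [q]. *)
Fixpoint bsum (s : seq J) (phi : (J -> nat) -> 'F_2) (q : J -> nat) : 'F_2 :=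
  if s is a :: s' then \sum_(t < m) bsum s' phi (upd q a t) else phi q.

Lemma updC q a b t r : a != b -> upd (upd q a t) b r = upd (upd q b r) a t.
Proof.
move=> ab; apply/funext => x; rewrite /upd.
case: (eqVneq x b) => [->|//]; case: (eqVneq b a) => [e|//].
by move: ab; rewrite e eqxx.
Qed.

Lemma eq_bsum s phi psi q :
  (forall r, (forall x, x \notin s -> r x = q x) ->
             (forall x, x \in s -> (r x < m)%N) -> phi r = psi r) ->
  bsum s phi q = bsum s psi q.
Proof.
elim: s q => [|a s IH] q /= h; first exact: h.
apply: eq_bigr => t _; apply: IH => r hr hr'; apply: h => x.
- rewrite inE => /norP[xa xs]; rewrite hr// /upd (negbTE xa)//.
- rewrite inE; case: (boolP (x \in s)) => [xs _|xs]; first exact: hr'.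
  by rewrite orbF => /eqP xa; rewrite hr// /upd xa eqxx.
Qed.

Lemma bsum_split s phi psi q :
  bsum s (fun r => phi r + psi r) q = bsum s phi q + bsum s psi q.
Proof.
elim: s q => [//|a s IH] q /=; rewrite -big_split.
by apply: eq_bigr => t _; rewrite IH.
Qed.

Lemma bsum0 s q : bsum s (fun _ => 0) q = 0.
Proof. by elim: s q => [//|a s IH] q /=; rewrite big1. Qed.

Lemma bsum_sum s (A : {set J}) (phi : J -> (J -> nat) -> 'F_2) q :
  bsum s (fun r => \sum_(a in A) phi a r) q = \sum_(a in A) bsum s (phi a) q.
Proof.
elim: s q => [//|a s IH] q /=; rewrite exchange_big /=.
by apply: eq_bigr => t _; rewrite IH.
Qed.

Lemma bsum_rem s a phi q : uniq s -> a \in s ->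
  bsum s phi q = bsum (a :: rem a s) phi q.
Proof.
elim: s q => [//|b s IH] q /andP[bs us]; rewrite inE /=.
case: (eqVneq b a) => [<-//|ba] /= as_.
under eq_bigr => t _ do rewrite IH//=.
rewrite exchange_big; apply: eq_bigr => t _; apply: eq_bigr => r _ /=.
by rewrite updC.
Qed.

Lemma bsum_step s a phi q t : a \notin s ->
  bsum s (fun r => phi (step r a)) (upd q a t) = bsum s phi (upd q a t.+1).
Proof.
elim: s q => [|b s IH] q /=.
  move=> _; congr phi; apply/funext => x; rewrite /step /upd eqxx.
  by case: (eqVneq x a).
rewrite inE => /norP[ab as_]; apply: eq_bigr => r _.
by rewrite (updC q t r ab) (updC q t.+1 r ab) IH.
Qed.

Lemma telescope2 (G : nat -> 'F_2) n :
  \sum_(t < n) (G t.+1 + G t) = G n + G 0%N.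
Proof.
elim: n => [|n IHn]; first by rewrite big_ord0 addFF.
by rewrite big_ord_recr /= IHn addrC -addrA (addrA (G n)) addFF add0r.
Qed.

Lemma bsum_divergence s a phi q : a \notin s ->
  bsum (a :: s) (fun r => phi (step r a) + phi r) q =
  bsum s phi (upd q a m) + bsum s phi (upd q a 0).
Proof.
move=> as_ /=; under eq_bigr => t _ do rewrite bsum_split bsum_step//.
exact: (telescope2 (fun t => bsum s phi (upd q a t))).
Qed.

(** Discrete Stokes formula: the sum over the box reduces to its faces. Those
    orthogonal to [a != j] contribute 0 by [cup_face], and so does the face where
    coordinate [j] is 0, on which label [j] is 0. On the face where coordinate
    [j] is [m] label [j] is 1, which leaves the same sum in one dimension less. *)
Lemma bsum_cup s q : uniq s -> bsum s (cup s [set x in s]) q = 1.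
Proof.
elim: s q => [//|j s IH] q us.
have /andP[js us'] := us.
rewrite (eq_bsum (psi := fun r => \sum_(a in [set x in j :: s])
   (label j (step r a) * cup s ([set x in j :: s] :\ a) (step r a) +
                 label j r * cup s ([set x in j :: s] :\ a) r))); last first.
  by move=> r _ _; exact: cup_divergence.
rewrite bsum_sum (bigD1 j) ?inE ?eqxx//.
rewrite big1 ?Monoid.mulm1; last first.
  move=> a; rewrite !inE => /andP[/orP[/eqP->|as_]]; first by rewrite eqxx.
  move=> aj; rewrite (bsum_rem (a := a))// ?inE ?as_ ?orbT//.
  have ar : a \notin rem a (j :: s) by rewrite mem_rem_uniq// !inE eqxx.
  rewrite (bsum_divergence (fun r => label j r * cup s ([set x in j :: s] :\ a) r))//.
  rewrite !(eq_bsum (psi := fun=> 0)) ?bsum0 ?addr0// => r rE _;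
    rewrite (@cup_face _ _ _ a) ?mulr0 ?inE ?eqxx// rE// /upd eqxx; by [left|right].
rewrite (bsum_rem (a := j)) ?inE ?eqxx//.
have -> : rem j (j :: s) = s by rewrite /= eqxx.
have -> : [set x in j :: s] :\ j = [set x in s].
  by apply/finset.setP => x; rewrite !inE; case: eqVneq => // ->; rewrite (negbTE js).
rewrite (bsum_divergence (fun r => label j r * cup s [set x in s] r))//.
rewrite [X in _ + X](eq_bsum (psi := fun=> 0)) ?bsum0 ?addr0; last first.
  by move=> r rE _; rewrite /label L0 ?mul0r// rE// /upd eqxx.
rewrite -[RHS](IH (upd q j m))//; apply: eq_bsum => r rE _.
by rewrite /label Lm ?mul1r// rE// /upd eqxx.
Qed.

Lemma bsum_neq0 s phi q : bsum s phi q != 0 ->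
  exists2 r, phi r != 0 & forall x, x \in s -> (r x < m)%N.
Proof.
move=> n0; apply: contrapT => h; case/eqP: n0.
rewrite -[RHS](bsum0 s q); apply: eq_bsum => r _ rm.
by apply/eqP; apply: contrapT => /negP r0; apply: h; exists r.
Qed.

(** The sum of the cup product over the grid is odd, so it does not vanish on
    some unit cube, and in that cube every label takes both values. *)
Theorem cubical_kuhn : exists q : J -> nat, (forall x, (q x < m)%N) /\
  forall j, exists r r', [/\ forall x, (q x <= r x <= (q x).+1)%N,
                   forall x, (q x <= r' x <= (q x).+1)%N
                 & L j r != L j r'].
Proof.
have := bsum_cup (fun=> 0%N) (enum_uniq J).
move=> e; have /bsum_neq0[q q0 qm] :
  bsum (enum J) (cup (enum J) [set x in enum J]) (fun=> 0%N) != 0.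
  by rewrite e oner_eq0.
exists q; split=> [x|j]; first by rewrite qm// mem_enum.
have [|r [r' [h1 h2 h3]]] := cup_neq0 q0 (j := j); first by rewrite mem_enum.
exists r, r'; split=> // x.
  by have := h1 x; rewrite !inE mem_enum addn1.
by have := h2 x; rewrite !inE mem_enum addn1.
Qed.
End Kuhn.

(** * Approximate Brouwer theorem *)

Definition unit_cube (R : realType) (J : Type) (x : J -> R) : Prop :=
  forall j, 0 <= x j <= 1.

(** Label [j] of a grid point records that [F] does not increase coordinate [j].
    In a unit cube of the grid where all labels take both values, each
    coordinate of [F x - x] changes sign, so it is small by uniform continuity.
    Only approximate fixed points are needed, which spares a compactness
    argument here. *)
Theorem approx_brouwer (R : realType) (J : finType) (F : (J -> R) -> J -> R) :
  (forall x, unit_cube x -> unit_cube (F x)) ->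
  (forall eps : R, 0 < eps -> exists2 delta : R, 0 < delta &
     forall x y, unit_cube x -> unit_cube y ->
     (forall j, `|x j - y j| <= delta) -> forall j, `|F x j - F y j| <= eps) ->
  forall eps : R, 0 < eps ->
  exists2 x, unit_cube x & forall j, `|F x j - x j| <= eps.
Proof.
move=> Fc Fu eps e0.
have [delta d0 Fd] := Fu (eps / 2) (divr_gt0 e0 (ltr0n _ 2)).
have mu0 : 0 < Num.min delta (eps / 2) by rewrite lt_min d0 divr_gt0.
pose m := (Num.truncn (Num.min delta (eps / 2))^-1).+1.
have m0 : 0 < m%:R :> R by rewrite ltr0n.
have mlt : m%:R^-1 < Num.min delta (eps / 2).
  rewrite -[ltRHS]invrK ltf_pV2 ?posrE ?invr_gt0//.
  by rewrite /m; exact: truncnS_gt.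
pose pt (q : J -> nat) : J -> R := fun j => Num.min 1 ((q j)%:R / m%:R).
have ptc q : unit_cube (pt q).
  move=> j; rewrite /pt le_min ler01 divr_ge0//=.

have ptd q r j : (q j <= r j <= (q j).+1)%N -> `|pt r j - pt q j| <= m%:R^-1.
  move=> /andP[h1 h2]; rewrite /pt.
  have a1 : (q j)%:R / m%:R <= (r j)%:R / m%:R :> R.
    by rewrite ler_pM2r ?invr_gt0// ler_nat.
  have a2 : (r j)%:R / m%:R <= (q j)%:R / m%:R + m%:R^-1 :> R.
    rewrite -[X in _ + X]mul1r -mulrDl ler_pM2r ?invr_gt0//.
    by rewrite natr1 ler_nat.
  have a3 : 0 < m%:R^-1 :> R by rewrite invr_gt0.
  rewrite ler_norml; case: (leP 1 ((q j)%:R / m%:R)) => ?;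
    case: (leP 1 ((r j)%:R / m%:R)) => ?; lra.
(* The first conjunct imposes the boundary value 0 on the face of coordinate 0,
   where F may fix the coordinate. *)
pose L (j : J) (q : J -> nat) := (q j != 0%N) && (F (pt q) j <= pt q j).
have L0 j q : q j = 0%N -> L j q = false by move=> h; rewrite /L h eqxx.
have Lm j q : q j = m -> L j q = true.
  move=> h; rewrite /L h /=; have /andP[_] := Fc _ (ptc q) j.
  by have -> : pt q j = 1 by rewrite /pt h divff ?minxx// lt0r_neq0.
have [q [qm qL]] := @cubical_kuhn J L m L0 Lm.
exists (pt q) => // j.
have far r : L j r = false -> pt r j <= F (pt r) j.
  rewrite /L; case: (eqVneq (r j) 0%N) => [r0 _|r0 /=].
    have -> : pt r j = 0 by rewrite /pt r0 mul0r; apply/min_idPr; exact: ler01.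
    by have /andP[] := Fc _ (ptc r) j.
  by move/negbT; rewrite -ltNge => /ltW.
have near r : L j r = true -> F (pt r) j <= pt r j by case/andP.
have [r [r' [h1 h2 h3]]] := qL j.
have cl s : (forall x, (q x <= s x <= (q x).+1)%N) ->
    `|pt s j - pt q j| <= eps / 2 /\ `|F (pt s) j - F (pt q) j| <= eps / 2.
  move=> hs; split.
    apply: (le_trans (ptd _ _ _ (hs j))); apply: ltW; apply: (lt_le_trans mlt).
    by rewrite ge_min lexx orbT.
  apply: Fd => // i; apply: (le_trans (ptd _ _ _ (hs i))); apply: ltW.
  by apply: (lt_le_trans mlt); rewrite ge_min lexx.
have [c1 c2] := cl _ h1; have [c3 c4] := cl _ h2.
move: c1 c2 c3 c4; rewrite !ler_norml.
move: (far r) (far r') (near r) (near r').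
case: (L j r) h3; case: (L j r') => // _ f1 f2 n1 n2.
- have := f2 erefl; have := n1 erefl; lra.
- have := f1 erefl; have := n2 erefl; lra.
Qed.

(** * Schauder's theorem between two profiles *)

Section Band.
Variable R : realType.

Lemma finite_lower_bound (J : finType) (delta : J -> R) :
  (forall j, 0 < delta j) -> exists2 d : R, 0 < d & forall j, d <= delta j.
Proof.
move=> d0; exists (\big[Order.min/1]_j delta j).
  by apply/bigmin_gtP; split.
by move=> j; exact: bigmin_le.
Qed.

Lemma finite_net (A d : R) : 0 < d -> exists l : seq R,
  forall s, `|s| <= A -> exists2 p, p \in l & `|s - p| <= d.
Proof.
move=> d0; exists [seq - A + k%:R * d | k <- iota 0 (Num.truncn ((A + A) / d)).+1].
move=> s; rewrite ler_norml => /andP[s1 s2].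
have sA0 : 0 <= (s + A) / d by rewrite divr_ge0 ?(ltW d0)//; lra.
pose k := Num.truncn ((s + A) / d).
exists (- A + k%:R * d).
  apply/mapP; exists k => //; rewrite mem_iota /= add0n ltnS.
  by apply: le_truncn; rewrite ler_pM2r ?invr_gt0//; lra.
have /andP[k1 k2] := truncn_itv sA0.
have {}k1 : k%:R * d <= s + A by rewrite -ler_pdivlMr.
have {}k2 : s + A < k.+1%:R * d by rewrite -ltr_pdivrMr.
move: k2; rewrite -natr1 mulrDl mul1r ler_norml => k2.
by rewrite /= ; apply/andP; split; lra.
Qed.

Definition clamp (a b x : R) : R := Num.max a (Num.min b x).

Lemma clamp_bnd a b x : a <= b -> a <= clamp a b x <= b.
Proof. by move=> ab; rewrite /clamp le_max lexx ge_max ab ge_min lexx. Qed.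

Lemma clamp_id a b x : a <= x <= b -> clamp a b x = x.
Proof. by case/andP=> ax xb; rewrite /clamp (min_idPr xb) (max_idPr ax). Qed.

Lemma clamp_lip a b x y : `|clamp a b x - clamp a b y| <= `|x - y|.
Proof.
have h1 := ler_norm (x - y); have h2 := ler_norm (y - x); rewrite distrC in h2.
rewrite /clamp; apply: (@le_trans _ _ `|Num.min b x - Num.min b y|).
  have h3 := ler_norm (Num.min b x - Num.min b y).
  have h4 := ler_norm (Num.min b y - Num.min b x); rewrite distrC in h4.
  by case: (leP a _) => ?; case: (leP a _) => ?; rewrite ler_norml; apply/andP; split; lra.
by case: (leP b x) => ?; case: (leP b y) => ?; rewrite ler_norml; apply/andP; split; lra.
Qed.

Variables (I : finType) (lo up : I -> R -> R).

Definition in_band (U : I -> R -> R) : Prop :=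
  (forall i, measurable_fun [set: R] (U i)) /\
  forall i x, lo i x <= U i x <= up i x.

Hypothesis mlo : forall i, measurable_fun [set: R] (lo i).
Hypothesis mup : forall i, measurable_fun [set: R] (up i).
Hypothesis lo0 : forall i x, 0 <= lo i x.
Hypothesis lo_up : forall i x, lo i x <= up i x.
Hypothesis up1 : forall i x, up i x <= 1.

Variable F : (I -> R -> R) -> I -> R -> R.
Hypothesis F_band : forall U, in_band U -> forall i x, lo i x <= F U i x <= up i x.
Hypothesis F_equicont : forall eps : R, 0 < eps -> exists2 delta : R, 0 < delta &
  forall U, in_band U -> forall i x y, `|x - y| <= delta ->
    `|F U i x - F U i y| <= eps.
Hypothesis F_cont : forall i x (eps : R), 0 < eps -> exists A delta : R, 0 < delta /\
  forall U V, in_band U -> in_band V ->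
    (forall j s, `|s| <= A -> `|U j s - V j s| <= delta) ->
    `|F U i x - F V i x| <= eps.

(** The interpolants are step functions: measurability is all that the operator
    requires of its argument, and their values do not have to add up as for a
    partition of unity. *)
Section interpolation.
Variables (K : nat) (a h : R).

Definition in_cell (j : nat) (s : R) : bool := j%:R * h <= s + a < j.+1%:R * h.

Definition step_interp (v : I * 'I_K -> R) (i : I) (s : R) : R :=
  \sum_(j < K) (if in_cell j s then v (i, j) else 0).

Hypothesis h0 : 0 < h.

Lemma step_interpE v i s (j : 'I_K) : in_cell j s -> step_interp v i s = v (i, j).
Proof.
move=> cj; rewrite /step_interp (bigD1 j)//= cj big1 ?addr0// => j' jj'.
case: ifPn => // cj'; exfalso; move: jj'; rewrite -val_eqE/= => /eqP; apply.
move: cj cj' => /andP[c1 c2] /andP[c3 c4].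
apply/eqP; rewrite eqn_leq; apply/andP; split; rewrite -ltnS -(ltr_nat R) -(ltr_pM2r h0).
  exact: le_lt_trans c3 c2.
exact: le_lt_trans c1 c4.
Qed.

Lemma step_interp_dist v v' i s d : 0 <= d -> (forall j, `|v j - v' j| <= d) ->
  `|step_interp v i s - step_interp v' i s| <= d.
Proof.
move=> d0 vd; have [[j cj]|nc] := pselect (exists j : 'I_K, in_cell j s).
  by rewrite !(step_interpE _ _ cj).
rewrite /step_interp !big1 ?subrr ?normr0// => j _;
  by case: ifPn => // cj; exfalso; apply: nc; exists j.
Qed.

Lemma measurable_step_interp v i : measurable_fun [set: R] (step_interp v i).
Proof.
apply: measurable_sum => j; apply: measurable_fun_ifT => //.
by apply: measurable_and; [apply: measurable_fun_ler|apply: measurable_fun_ltr] => //;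
  apply: measurable_funD.
Qed.

End interpolation.

(** [F] is applied to a clamped step function and sampled at the nodes, which
    gives a self-map of a cube. Clamping does not move [F U], which lies in the
    band, and it is 1-Lipschitz; so closeness at the nodes passes to [U] and
    [F U] on the whole interval by equicontinuity. *)
Lemma band_approx_fixed_point (n : nat) : exists2 U, in_band U &
  forall i s, `|s| <= n%:R -> `|U i s - F U i s| <= n.+1%:R^-1.
Proof.
pose e : R := n.+1%:R^-1 / 2.
have e0 : 0 < e by rewrite divr_gt0 ?invr_gt0 ?ltr0n.
have [h h0 hF] := F_equicont e0.
pose K := (Num.truncn ((n%:R + n%:R) / h)).+1.
pose pt (j : 'I_K) : R := - n%:R + (j%:R * h).
pose U (v : I * 'I_K -> R) i s := clamp (lo i s) (up i s) (step_interp n%:R h v i s).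
have Ub v : in_band (U v).
  split=> [i|i s]; last exact: clamp_bnd.
  apply: measurable_maxr => //; apply: measurable_minr => //.
  exact: measurable_step_interp.
pose G v (ij : I * 'I_K) := F (U v) ij.1 (pt ij.2).
have [||v _ vG] := @approx_brouwer R _ G _ _ e e0.
- move=> v _ [i j]; rewrite /G /=; have /andP[f1 f2] := F_band (Ub v) i (pt j).
  by rewrite (le_trans _ f1)//= (le_trans f2).
- move=> eps eps0.
  have /choice[delta dP] : forall ij : I * 'I_K, exists d, 0 < d /\
      forall v v', (forall k, `|v k - v' k| <= d) -> `|G v ij - G v' ij| <= eps.
    move=> ij; have [A [d [d0 dP]]] := F_cont ij.1 (pt ij.2) eps0.
    exists d; split=> // v v' vv'; apply: dP => // i s _.
    apply: (le_trans (clamp_lip _ _ _ _)).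
    by apply: step_interp_dist => //; exact: ltW.
  have [d d0 dle] := finite_lower_bound (fun ij => (dP ij).1).
  exists d => // v v' _ _ vv' ij; apply: (dP ij).2 => k.
  exact: (le_trans (vv' k)).
exists (U v) => // i s; rewrite ler_norml => /andP[s1 s2].
have sn0 : 0 <= (s + n%:R) / h by rewrite divr_ge0 ?(ltW h0)//; lra.
have /andP[k1 k2] := truncn_itv sn0.
have kK : (Num.truncn ((s + n%:R) / h) < K)%N.
  by rewrite ltnS; apply: le_truncn; rewrite ler_pM2r ?invr_gt0//; lra.
pose j := Ordinal kK.
have k1' : j%:R * h <= s + n%:R by rewrite -ler_pdivlMr.
have k2' : s + n%:R < j.+1%:R * h by rewrite -ltr_pdivrMr.
have cj : in_cell n%:R h j s by rewrite /in_cell k1' k2'.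
rewrite -[F (U v) i s](clamp_id (F_band (Ub v) i s)).
apply: (le_trans (clamp_lip _ _ _ _)); rewrite (step_interpE h0 _ _ cj).
have := vG (i, j); rewrite /G/= => g1.
have : `|F (U v) i (pt j) - F (U v) i s| <= e.
  apply: hF => //; rewrite /pt ler_norml.
  by move: k2'; rewrite -natr1 mulrDl mul1r => k2'; apply/andP; split; lra.
move: g1; rewrite !ler_norml.
have -> : n.+1%:R^-1 = e + e by rewrite -splitr.
lra.
Qed.

(** The functions [F (U_ n)] have a pointwise cluster point [u] by Tychonoff's
    theorem. Equicontinuity passes to [u], hence closeness on a finite net gives
    uniform closeness on bounded sets; there [U_ n] is close to [F (U_ n)], so
    [F u] is close to [F (U_ n)], and to [u]. *)
Theorem band_fixed_point : exists2 U, in_band U & F U = U.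
Proof.
have /choice[U_ UP] : forall n, exists U, in_band U /\
    forall i s, `|s| <= n%:R -> `|U i s - F U i s| <= n.+1%:R^-1.
  by move=> n; have [U ? ?] := band_approx_fixed_point n; exists U.
have Ub n := (UP n).1; have UF n := (UP n).2.
pose T : topologicalType := prod_topology (fun _ : I * R => (R : topologicalType)).
pose w (n : nat) : T :=
  fun p => F (U_ n) p.1 p.2.
pose C : set T :=
  [set f | forall p, `[0, 1]%classic (f p)].
have cC : compact C.
  apply: (@tychonoff (I * R)%type (fun _ => (R : topologicalType))
    (fun _ => `[0, 1]%classic)) => p.
  exact: segment_compact.
have wC n : C (w n).
  move=> p /=; rewrite in_itv/=; have /andP[f1 f2] := F_band (Ub n) p.1 p.2.
  by rewrite (le_trans _ f1)//= (le_trans f2).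
have [g [_ gcl]] : C `&` cluster (w @ \oo) !=set0.
  have PF := fmap_proper_filter w eventually_filter.
  by apply: (cC _ PF); exists 0%N => // n _; exact: wC.
have gw (l : seq (I * R)) (e : R) (N : nat) : 0 < e ->
    exists2 n, (N <= n)%N & forall p, p \in l -> `|w n p - g p| <= e.
  move=> e0.
  have nb : nbhs g [set f : T | forall p, p \in l -> `|f p - g p| <= e].
    elim: l => [|p l IH]; first by apply: (@filterE T (nbhs g)) => f p.
    have pc : nbhs g [set f : T | `|f p - g p| <= e].
      have gp : nbhs (g p) [set y : R | `|y - g p| <= e].
        apply/nbhs_ballP; exists e => //= y; rewrite /ball/= distrC; exact: ltW.
      exact: (@proj_continuous (I * R)%type (fun _ => (R : topologicalType)) p g _ gp).
    apply: (@filterS2 T (nbhs g) _ _ _ _ _ pc IH) => f /= f1 f2 q; rewrite inE => /predU1P[->//|].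
    exact: f2.
  have wA : (w @ \oo) [set f | exists2 n, (N <= n)%N & f = w n].
    by exists N => // n /= Nn; exists n.
  by have [f [[n Nn ->] fl]] := gcl _ _ wA nb; exists n.
pose u i x := g (i, x).
have uband i x : lo i x <= u i x <= up i x.
  apply/andP; split; apply/ler_addgt0Pr => e e0;
    have [n _ /(_ (i, x))] := gw [:: (i, x)] e 0%N e0;
    rewrite inE eqxx => /(_ isT); rewrite /w/= ler_norml;
    have := F_band (Ub n) i x; rewrite /u; lra.
have ucont (eps : R) : 0 < eps -> exists2 delta, 0 < delta &
    forall i x y, `|x - y| <= delta -> `|u i x - u i y| <= eps.
  move=> eps0; have [d d0 dF] := F_equicont eps0; exists d => // i x y xy.
  apply/ler_addgt0Pr => e e0.
  have [n _ nP] := gw [:: (i, x); (i, y)] (e / 2) 0%N (divr_gt0 e0 (ltr0n _ 2)).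
  have := nP (i, x); rewrite !inE eqxx => /(_ isT).
  have := nP (i, y); rewrite !inE eqxx orbT => /(_ isT).
  have := dF _ (Ub n) i x y xy.
  rewrite /w /u/= !ler_norml; lra.
have ub : in_band u.
  split=> // i; apply: continuous_measurable_fun => x.
  apply/cvgrPdist_le => eps eps0; have [d d0 ud] := ucont _ eps0.
  near=> y; apply: ud; near: y.
  by apply: (@cvgr_dist_le _ _ _ (nbhs x) _ id x).
exists u => //; apply/funext => i; apply/funext => x.
apply/eqP; rewrite -subr_eq0 -normr_le0; apply/ler_addgt0Pr => e e0.
have e2 : 0 < e / 2 by rewrite divr_gt0.
have [A [d [d0 dP]]] := F_cont i x e2.
(* U_ n is compared with u through F (U_ n) at s, F (U_ n) at a node, and u at the
   node: four steps. *)
have d4 : 0 < d / 4 by rewrite divr_gt0.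
have [h1 h10 h1u] := ucont _ d4.
have [h2 h20 h2F] := F_equicont d4.
have [l lP] := @finite_net A (Num.min h1 h2) ltac:(by rewrite lt_min h10 h20).
have m0 : 0 < Num.min (e / 2) (d / 4) by rewrite lt_min e2 d4.
pose N := maxn (Num.truncn `|A|).+1 (Num.truncn (d / 4)^-1).+1.
have [n Nn nP] := gw ((i, x) :: [seq (j, p) | j <- enum I, p <- l]) _ N m0.
have nA : `|A| <= n%:R.
  apply: ltW; apply: (lt_le_trans (truncnS_gt _)); rewrite ler_nat.
  by apply: leq_trans Nn; rewrite leq_maxl.
have nd : n.+1%:R^-1 <= d / 4.
  rewrite -[leRHS]invrK lef_pV2 ?posrE ?invr_gt0//.
  apply: ltW; apply: (lt_le_trans (truncnS_gt _)); rewrite ler_nat.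
  by apply: leq_trans (leq_trans Nn _) => //; rewrite leq_maxr.
have close j s : `|s| <= A -> `|U_ n j s - u j s| <= d.
  move=> sA; have [p pl] := lP s sA; rewrite le_min => /andP[sp1 sp2].
  have := h1u j s p sp1; have := h2F _ (Ub n) j s p sp2.
  have := UF n j s (le_trans sA (le_trans (ler_norm _) nA)).
  have /nP : (j, p) \in (i, x) :: [seq (j, p) | j <- enum I, p <- l].
    by rewrite inE; apply/orP; right; apply/allpairsP; exists (j, p); rewrite mem_enum.
  rewrite le_min => /andP[_]; rewrite /w /u/=.
  rewrite !ler_norml; move: nd; move: (n.+1%:R^-1 : R) => r; lra.
have := dP _ _ (Ub n) ub close.
have := nP (i, x); rewrite inE eqxx => /(_ isT).
rewrite le_min => /andP[+ _]; rewrite /w /u/= !ler_norml.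
by lra.
Unshelve. all: by end_near. Qed.

End Band.

(** * Borel densities of Lebesgue measurable kernels *)

Section Transfer.
Variable R : realType.
Notation mu := (@lebesgue_measure R).
Notation cmu := (@completed_lebesgue_measure R).
Let C := caratheodory_type ((wlength (idfun : R -> R))^*)%mu.

Lemma borel_completed_measurable (A : set R) :
  measurable (A : set (measurableTypeR R)) -> measurable (A : set C).
Proof. exact: sub_caratheodory. Qed.

Lemma measurable_id_completed :
  measurable_fun [set: C] (id : C -> measurableTypeR R).
Proof. by move=> _ A mA; rewrite setTI; exact: borel_completed_measurable. Qed.

(** Both measures are restrictions of the same outer measure, so Lebesgue measure
    is the image of its completion under the identity. *)
Lemma integral_completed (G : R -> \bar R) :
  measurable_fun [set: measurableTypeR R] G -> (forall x, 0 <= G x)%E ->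
  (\int[cmu]_x G x = \int[mu]_x G x)%E.
Proof.
move=> mG G0.
rewrite -(ge0_integral_pushforward measurable_id_completed cmu (D := setT))//.
Qed.

Lemma completed_measurable_split (E : set R) : measurable (E : set C) ->
  exists A Z : set R, [/\ measurable (A : set (measurableTypeR R)),
   measurable (Z : set (measurableTypeR R)), mu Z = 0%E &
   E `\` Z = A `\` Z].
Proof.
move=> mE.
have : (completed_algebra_gen mu).-sigma.-measurable E.
  by rewrite completed_caratheodory_measurable.
rewrite g_sigma_completed_algebra_genE => -[A mA [N [Z [mZ Z0 NZ]]] <-].
exists A, Z; split => //; apply/seteqP; split => x /=.
  by case=> [[Ax|/NZ //] nZ].
by case=> Ax nZ; split => //; left.
Qed.

(** Each set [k > q] with [q] rational is Borel up to a null set; discarding the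
    union of these countably many null sets makes them all Borel at once. The
    discarded set is made symmetric so that evenness of [k] survives. *)
Lemma borel_modification (k : R -> R) : measurable_fun [set: C] (k : C -> R) ->
  exists Z : set R, [/\ measurable (Z : set (measurableTypeR R)), mu Z = 0%E,
    forall x, Z (- x) <-> Z x &
    measurable_fun [set: R] (fun x => if x \in Z then 0 else k x)].
Proof.
move=> mk.
have /choice[A_ /choice[Z_ AZ]] : forall q : rat, exists A Z : set R,
   [/\ measurable (A : set (measurableTypeR R)),
   measurable (Z : set (measurableTypeR R)), mu Z = 0%E &
   (k @^-1` `]ratr q, +oo[) `\` Z = A `\` Z].
  move=> q; apply: completed_measurable_split.
  by rewrite -[X in measurable X]setTI; apply: mk.
pose Z0 := \bigcup_n Z_ (odflt 0 (unpickle n : option rat)).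
have mZ0 : measurable (Z0 : set (measurableTypeR R)).
  by apply: bigcupT_measurable => n; have [] := AZ (odflt 0 (unpickle n)).
have mnegl : mu.-negligible Z0.
  by apply: negligible_bigcup => n; have [_ ? ? _] := AZ (odflt 0 (unpickle n));
     apply/negligibleP.
have Z00 : mu Z0 = 0%E by exact/negligibleP.
have mopp : measurable_fun [set: measurableTypeR R] (-%R : R -> measurableTypeR R).
  exact: oppr_measurable.
have mNZ : measurable ((-%R @^-1` Z0) : set (measurableTypeR R)).
  by rewrite -[X in measurable X]setTI; apply: mopp.
have NZ0 : mu (-%R @^-1` Z0) = 0%E.
  by rewrite -[LHS]/(pushforward mu (-%R : _ -> measurableTypeR R) Z0) lebesgue_measureN.
pose Z := Z0 `|` -%R @^-1` Z0.
have mZ : measurable (Z : set (measurableTypeR R)) by exact: measurableU.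
have ZE q : Z_ q `<=` Z.
  by move=> x Zx; left; exists (pickle q); [by []|rewrite pickleK].
exists Z; split => //.
- by apply/negligibleP => //; apply: negligibleU => //; apply/negligibleP.
- by move=> x; rewrite /Z/= opprK; split => -[]; [right|left|right|left].
- apply: (measurability _ (RGenOInfty.measurableE R)).
  move=> _ [_ [r ->] <-]; rewrite setTI.
  have -> : (fun x => if x \in Z then 0 else k x) @^-1` `]r, +oo[%classic =
    \bigcup_(q : rat) (if r < ratr q then
      (A_ q `\` Z) `|` (if ratr q < 0 :> R then Z else set0) else set0).
    apply/seteqP; split => x /=.
      rewrite in_itv/= andbT => /rat_in_itvoo[q]; rewrite in_itv/= => /andP[rq qx].
      exists q => //; rewrite rq; move: qx; case: ifPn => [/set_mem xZ q0|/negP xZ qx].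
        by right; rewrite q0.
      left; have nZ : ~ Z x by move=> /mem_set.
      split => //.
      have [_ _ _ /seteqP[/(_ x) + _]] := AZ q; case; last by [].
      by split; [rewrite /= in_itv/= qx|move=> /ZE].
    case=> q _; case: ifPn => // rq /= [[Ax nZ]|]; rewrite in_itv/= andbT.
      rewrite memNset//; apply: (lt_trans rq).
      have [_ _ _ /seteqP[_ /(_ x)]] := AZ q; case; first by split => // /ZE.
      by rewrite /= in_itv/= andbT.
    by case: ifPn => // q0 xZ; rewrite mem_set//; exact: (lt_trans rq).
  apply: bigcupT_measurable_rat => q; case: ifPn => // _.
  have [mA _ _ _] := AZ q.
  by apply: measurableU; [exact: measurableD|case: ifPn].
Qed.

Definition even_density (kap : R -> R) : Prop :=
  [/\ measurable_fun [set: R] kap, forall x, 0 <= kap x,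
      forall x, kap (- x) = kap x, (\int[mu]_y (kap y)%:E = 1)%E
    & forall lambda : R, 0 <= lambda ->
        (\int[mu]_y (expR (lambda * y) * kap y)%:E < +oo)%E].

Lemma kernel_density (k : R -> R) : dispersal_kernel k ->
  exists2 kap, even_density kap & forall G : R -> R, measurable_fun [set: R] G ->
    (forall x, 0 <= G x) ->
    (\int[cmu]_y (G y * k y)%:E = \int[mu]_y (G y * kap y)%:E)%E.
Proof.
move=> [k0 ki ke k1 kM].
have mk : measurable_fun [set: C] (k : C -> R) by apply/measurable_EFinP/measurable_int/ki.
have [Z [mZ Z0 Zs mkap]] := borel_modification mk.
set kap := fun x : R => _ in mkap.
have kap0 x : 0 <= kap x by rewrite /kap; case: ifP.
have kE (G : R -> R) : measurable_fun [set: R] G -> (forall x, 0 <= G x) ->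
    (\int[cmu]_y (G y * k y)%:E = \int[mu]_y (G y * kap y)%:E)%E.
  move=> mG G0.
  have mG' : measurable_fun [set: C] (G : C -> R).
    exact: (measurableT_comp mG measurable_id_completed).
  have mkap' : measurable_fun [set: C] (kap : C -> R).
    exact: (measurableT_comp mkap measurable_id_completed).
  rewrite -integral_completed; last 2 first.
  - by apply/measurable_EFinP; exact: measurable_funM.
  - by move=> x; rewrite lee_fin mulr_ge0.
  apply: ge0_ae_eq_integral; first exact: measurableT.
  - by apply/measurable_EFinP; exact: measurable_funM.
  - by apply/measurable_EFinP; exact: measurable_funM.
  - by move=> x _; rewrite lee_fin mulr_ge0.
  - by move=> x _; rewrite lee_fin mulr_ge0.
  exists Z; split; [exact: borel_completed_measurable|exact: Z0|].
  move=> x /= h; apply: contrapT => nZ; apply: h => _.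
  by rewrite /kap memNset.
exists kap => //; split=> //.
- move=> x; rewrite /kap ke; congr (if _ then _ else _).
  by apply/idP/idP => /set_mem /Zs /mem_set.
- rewrite -k1; have := kE (cst 1) (measurable_cst _) (fun=> ler01).
  by under eq_integral do rewrite mul1r; move=> ->; apply: eq_integral => x _; rewrite mul1r.
- move=> l l0; rewrite -(kE (fun y => expR (l * y))).
  + by under eq_integral do rewrite mulrC; exact: kM.
  + by apply: measurableT_comp => //; exact: measurable_funM.
  + by move=> x; exact: expR_ge0.
Qed.

End Transfer.

(** * Reflection and translation of integrals *)

Section Reflection.
Variable R : realType.
Notation mu := (@lebesgue_measure R).
Notation integrable f := (mu.-integrable [set: R] (EFin \o f)).

Lemma measurable_reflect (xi : R) :
  measurable_fun [set: measurableTypeR R] (fun y : R => xi - y : measurableTypeR R).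
Proof. exact: measurable_funB. Qed.

Let reflected (xi : R) : {measure set (measurableTypeR R) -> \bar R} :=
  measure_function_pushforward__canonical__measure_function_Measure mu
    (measurable_reflect xi).

Lemma lebesgue_measure_reflect (xi : R) (A : set R) : measurable A ->
  reflected xi A = mu A.
Proof.
move=> mA.
apply/esym; apply: lebesgue_measure_unique => //= _ [[a b]] _ <-.
rewrite /pushforward.
have -> : (fun y : R => xi - y) @^-1` `]a, b]%classic = `[xi - b, xi - a[%classic.
  apply/seteqP; split => y /=; rewrite !in_itv/= => /andP[h1 h2]; apply/andP; split; lra.
rewrite !lebesgue_measure_itv/= !lte_fin ltrD2l ltrN2.
by case: ifP => // _; congr (_%:E); lra.
Qed.

Lemma ge0_integral_reflect (xi : R) (f : R -> \bar R) :
  measurable_fun [set: R] f -> (forall y, 0 <= f y)%E ->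
  (\int[mu]_y f (xi - y)%R = \int[mu]_y f y)%E.
Proof.
move=> mf f0.
transitivity (\int[reflected xi]_y f y)%E.
  by rewrite (ge0_integral_pushforward (measurable_reflect xi) mu (D := setT)).
by apply: eq_measure_integral => A mA _; exact: lebesgue_measure_reflect.
Qed.

Lemma integrable_reflect xi f : integrable f -> integrable (fun y => f (xi - y)).
Proof.
move=> /integrableP[mf fi]; apply/integrableP; split.
  exact: (measurableT_comp mf (measurable_reflect xi)).
rewrite (ge0_integral_reflect xi (f := fun y => `|(f y)%:E|%E))//.
exact: measurableT_comp.
Qed.

Lemma Rintegral_reflect xi f : integrable f ->
  \int[mu]_y f (xi - y) = \int[mu]_y f y.
Proof.
move=> fi; congr fine.
transitivity (\int[reflected xi]_y (f y)%:E)%E.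
  rewrite (integral_pushforward (measurable_reflect xi) (D := setT))//.
  - exact: (measurable_int mu).
  - exact: integrable_reflect.
by apply: eq_measure_integral => A mA _; exact: lebesgue_measure_reflect.
Qed.

Lemma integrable_translate h f : integrable f -> integrable (fun y => f (y + h)).
Proof.
move=> fi; have := integrable_reflect 0 (integrable_reflect h fi).
by apply: eq_integrable => // y _; rewrite /= sub0r opprK addrC.
Qed.

Lemma Rintegral_translate h f : integrable f ->
  \int[mu]_y f (y + h) = \int[mu]_y f y.
Proof.
move=> fi; rewrite -(Rintegral_reflect h fi).
rewrite -(Rintegral_reflect 0 (integrable_reflect h fi)).
by apply: eq_Rintegral => y _; rewrite sub0r opprK addrC.
Qed.

End Reflection.

(** * Averages against an even density *)

Section Density.
Variable R : realType.
Notation mu := (@lebesgue_measure R).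
Notation integrable f := (mu.-integrable [set: R] (EFin \o f)).
Variable kap : R -> R.
Hypothesis kd : even_density kap.

Let mk : measurable_fun [set: R] kap. Proof. by case: kd. Qed.
Let k0 x : 0 <= kap x. Proof. by case: kd. Qed.
Let ke x : kap (- x) = kap x. Proof. by case: kd. Qed.

Lemma integrable_add f g : integrable f -> integrable g ->
  integrable (fun y => f y + g y).
Proof. by move=> fi gi; have := integrableD measurableT fi gi; exact: eq_integrable. Qed.

Lemma integrable_density : integrable kap.
Proof.
case: kd => _ _ _ k1 _; apply/integrableP; split; first exact/measurable_EFinP.
have -> : (\int[mu]_x `|(EFin \o kap) x| = \int[mu]_x (kap x)%:E)%E.
  by apply: eq_integral => x _ /=; rewrite ger0_norm.
by rewrite k1 ltry.
Qed.

Lemma Rintegral_density : \int[mu]_y kap y = 1.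
Proof. by case: kd => _ _ _ k1 _; rewrite /Rintegral k1. Qed.

Lemma measurable_expMl (l : R) : measurable_fun [set: R] (fun y : R => expR (l * y)).
Proof. by apply: measurableT_comp => //; exact: measurable_funM. Qed.

Lemma integrable_exp (l : R) : integrable (fun y => expR (l * y) * kap y).
Proof.
wlog l0 : l / 0 <= l.
  move=> H; case: (leP 0 l) => [|/ltW l0]; first exact: H.
  have := integrable_reflect 0 (H (- l) _); rewrite oppr_ge0 => /(_ l0).
  by apply: eq_integrable => // y _; rewrite /= sub0r mulrNN ke.
case: kd => _ _ _ _ /(_ l l0) kl; apply/integrableP; split.
  by apply/measurable_EFinP/measurable_funM => //; exact: measurable_expMl.
rewrite (le_lt_trans _ kl)// le_eqVlt; apply/orP; left; apply/eqP.
by apply: eq_integral => x _ /=; rewrite ger0_norm// mulr_ge0// expR_ge0.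
Qed.

Definition mgf (l : R) : R := \int[mu]_y (expR (l * y) * kap y).

Lemma mgfN l : mgf (- l) = mgf l.
Proof.
rewrite /mgf -(Rintegral_reflect 0 (integrable_exp l)).
by apply: eq_Rintegral => y _; rewrite sub0r ke mulrN mulNr.
Qed.

Lemma integrable_bounded (G : R -> R) (M : R) : measurable_fun [set: R] G ->
  (forall y, `|G y| <= M) -> integrable (fun y => G y * kap y).
Proof.
move=> mG GM; have := integrableZl measurableT M integrable_density.
apply: le_integrable => //; first exact/measurable_EFinP/measurable_funM.
move=> x _; rewrite /= lee_fin !normrM ler_wpM2r//.
by rewrite (le_trans (GM x))// ler_norm.
Qed.

Lemma integrable_cosh : integrable (fun y => (expR y + expR (- y)) * kap y).
Proof.
have h1 := integrable_exp 1; have h2 := integrable_exp (- 1).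
apply: eq_integrable (integrableD measurableT h1 h2) => // y _ /=.
by rewrite -EFinD mul1r mulN1r mulrDl.
Qed.

Lemma Rintegral_cosh : \int[mu]_y ((expR y + expR (- y)) * kap y) = 2 * mgf 1.
Proof.
transitivity (mgf 1 + mgf (- 1)); last by rewrite mgfN; lra.
rewrite /mgf -RintegralD//; [|exact: integrable_exp..].
by apply: eq_Rintegral => y _; rewrite mul1r mulN1r mulrDl.
Qed.

(** By evenness, the average of [e^(l y)] is that of [cosh (l y)]. *)
Lemma mgf_ge1 l : 1 <= mgf l.
Proof.
suff : 2 <= mgf l + mgf (- l) by rewrite mgfN; lra.
rewrite /mgf -RintegralD//; [|exact: integrable_exp..].
have -> : 2 = \int[mu]_y (2 * kap y).
  by rewrite RintegralZl ?Rintegral_density ?mulr1//; exact: integrable_density.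
apply: le_Rintegral => //.
- exact: (integrableZl measurableT 2 integrable_density).
- exact: (integrableD measurableT (integrable_exp _) (integrable_exp _)).
- move=> y _; rewrite -mulrDl ler_wpM2r//.
  by have := expR_ge1Dx (l * y); have := expR_ge1Dx (- l * y); lra.
Qed.

(** The term in [eta] absorbs the region where [G] and [H] differ much: there
    [e^y + e^(-y)] is large, and its average is finite. *)
Lemma Rintegral_dist (G H : R -> R) (delta eta : R) :
  measurable_fun [set: R] G -> measurable_fun [set: R] H ->
  (forall y, `|G y| <= 1) -> (forall y, `|H y| <= 1) ->
  (forall y, `|G y - H y| <= delta + eta * (expR y + expR (- y))) ->
  `|\int[mu]_y (G y * kap y) - \int[mu]_y (H y * kap y)| <= delta + eta * (2 * mgf 1).
Proof.
move=> mG mH G1 H1 GH.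
have iG := integrable_bounded mG G1; have iH := integrable_bounded mH H1.
rewrite -RintegralB//; apply: (le_trans (le_normr_Rintegral _ _)) => //.
  exact: (integrableB measurableT iG iH).
have id := integrableZl measurableT delta integrable_density.
have ic := integrableZl measurableT eta integrable_cosh.
rewrite -Rintegral_cosh -[delta in leRHS]mulr1 -Rintegral_density.
rewrite -(RintegralZl delta measurableT integrable_density).
rewrite -(RintegralZl eta measurableT integrable_cosh).
rewrite -RintegralD//; apply: le_Rintegral => //.
- have := integrable_abse (integrableB measurableT iG iH).
  by apply: eq_integrable.
- exact: (integrableD measurableT id ic).
- move=> y _; rewrite -mulrBl normrM (ger0_norm (k0 y)).
  by rewrite (mulrA eta) -mulrDl ler_wpM2r.
Qed.

Lemma cosh_tail (A y : R) : A <= `|y| -> 1 <= expR (- A) * (expR y + expR (- y)).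
Proof.
move=> Ay; rewrite -(mulVf (lt0r_neq0 (expR_gt0 A))) -expRN ler_wpM2l ?expR_ge0//.
apply: (@le_trans _ _ (expR `|y|)); first by rewrite ler_expR.
have ey := expR_ge0 y; have eNy := expR_ge0 (- y).
by case: (ger0P y) => _; lra.
Qed.

Lemma exp_small (c eps : R) : 0 <= c -> 0 < eps -> exists2 A, 0 <= A & expR (- A) * c <= eps.
Proof.
(* This A suffices because 1 + A <= e^A. *)
move=> c0 e0; exists (c / eps); first by rewrite divr_ge0// ltW.
rewrite expRN mulrC ler_pdivrMr ?expR_gt0//.
have := expR_ge1Dx (c / eps); rewrite -(ler_pM2l e0) mulrDr mulr1 mulrCA divff ?mulr1 ?gt_eqF//.
by lra.
Qed.

Lemma mgf_continuous : continuous mgf.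
Proof.
move=> a; pose V := `|a| + 1.
have Va : a \in `]-V, V[%classic.
  by rewrite inE/= in_itv/= -ltr_norml /V ltrDl.
have ig : integrable (fun y => expR (V * y) * kap y + expR (- V * y) * kap y).
  exact: (integrableD measurableT (integrable_exp _) (integrable_exp _)).
apply: (@continuity_under_integral R _ _ mu (fun l y => expR (l * y) * kap y)
  setT measurableT (- V) V _ _ _ ig) => //.
- by move=> l _; exact: integrable_exp.
- apply: aeW => y _ l _; apply: cvgMr_tmp => /=.
  apply: continuous_comp; last exact: continuous_expR.
  by apply: cvgMr_tmp; exact: cvg_id.
- move=> l /=; rewrite in_itv/= => /andP[l1 l2]; apply: aeW => y _.
  rewrite ger0_norm ?mulr_ge0 ?expR_ge0// -mulrDl ler_wpM2r//.
  case: (lerP 0 y) => y0.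
    apply: (@le_trans _ _ (expR (V * y))); last by rewrite lerDl expR_ge0.
    by rewrite ler_expR ler_wpM2r// ltW.
  apply: (@le_trans _ _ (expR (- V * y))); last by rewrite lerDr expR_ge0.
  by rewrite ler_expR ler_nM2r// ltW.
Qed.

Lemma integrable_normB (f g : R -> R) : integrable f -> integrable g ->
  integrable (fun y => `|f y - g y|).
Proof.
move=> fi gi; have := integrable_abse (integrableB measurableT fi gi).
by apply: eq_integrable.
Qed.

(** On a large interval the density is approximated in L^1 by a continuous
    function, which is then multiplied by the cutoff [chi]; the tail is
    controlled by the exponential moments. *)
Lemma density_continuous_approx (eps : R) : 0 < eps ->
  exists gam : R -> R, exists B S : R, [/\ continuous gam, forall x, `|gam x| <= S,
    forall x, B <= `|x| -> gam x = 0, integrable gam &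
    \int[mu]_y `|kap y - gam y| <= eps].
Proof.
move=> e0; have e2 : 0 < eps / 2 by rewrite divr_gt0.
have m0 : 0 <= 2 * mgf 1 by have := mgf_ge1 1; lra.
have [A A0 hA] := exp_small m0 e2.
pose B := A + 1; pose E := `[- B, B]%classic : set R.
have iE : mu.-integrable E (EFin \o kap).
  by apply: (integrableS measurableT _ _ integrable_density) => //; exact: measurable_itv.
have muE : (mu E < +oo)%E.
  by rewrite lebesgue_measure_itv/=; case: ifP => _; rewrite ltry.
have mE : measurable (E : set (measurableTypeR R)) by exact: measurable_itv.
have [g_ [cg ig ag]] := approximation_continuous_integrable mE muE iE.
have [n gn] : exists n, (\int[mu]_(z in E) `|(kap z - g_ n z)%:E| <= (eps / 2)%:E)%E.
  have : nbhs (0%E : \bar R) [set x | (x < (eps / 2)%:E)%E].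
    by apply: open_nbhs_nbhs; split; [exact: open_ereal_lt_ereal|rewrite /= lte_fin].
  by move/ag => [N _ /(_ N (leqnn N)) h]; exists N; exact: ltW.
pose g := g_ n.
have [M gM] : exists M, forall x, E x -> `|g x| <= M.
  have cE : compact (g @` E).
    apply: continuous_compact; last exact: segment_compact.
    by apply: continuous_subspaceT; exact: cg.
  have [M [_ hM]] := compact_bounded cE.
  exists (`|M| + 1) => x Ex; apply: (hM (`|M| + 1)); last by exists x.
  by rewrite (le_lt_trans (ler_norm _))// ltrDl.
pose chi (y : R) := Num.max 0 (Num.min 1 (B - `|y|)).
have chi01 y : 0 <= chi y <= 1.
  by rewrite /chi le_max lexx/= ge_max ler01 ge_min lexx.
have chi0 y : B <= `|y| -> chi y = 0.
  move=> By; rewrite /chi; apply/max_idPl.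
  by rewrite ge_min subr_le0 By orbT.
have chi1 y : `|y| <= A -> chi y = 1.
  move=> yA; rewrite /chi (min_idPl _) ?(max_idPr _)//.
  by rewrite /B; lra.
have cchi : continuous chi.
  move=> y; apply/cvgrPdist_le => e e1; near=> z.
  apply: (le_trans (clamp_lip 0 1 _ _)).
  have -> : B - `|y| - (B - `|z|) = `|z| - `|y| by lra.
  apply: (le_trans (ler_dist_dist _ _)); rewrite distrC; near: z.
  exact: (@cvgr_dist_le _ _ _ (nbhs y) _ id y).
pose gam y := g y * chi y.
have Ey y : `|y| < B -> E y.
  by move=> yB; rewrite /E/= in_itv/= -ler_norml ltW.
have M0 : 0 <= M.
  by apply: le_trans (gM 0 _) => //; apply: Ey; rewrite normr0 /B; lra.
have cgam : continuous gam by move=> y; apply: cvgM; [exact: cg|exact: cchi].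
have gam0 y : B <= `|y| -> gam y = 0 by move=> By; rewrite /gam chi0 ?mulr0.
have gamM y : `|gam y| <= M.
  case: (ltP `|y| B) => [/Ey/gM h|/gam0 ->]; last by rewrite normr0.
  have /andP[c0 c1] := chi01 y.
  by rewrite /gam normrM (ger0_norm c0) (le_trans _ h)// ler_piMr.
have igam : integrable gam.
  have iM : integrable (fun y => M * \1_E y).
    have := integrableZl measurableT M (integrable_indic_itv (- B) B true false).
    by apply: eq_integrable.
  apply: le_integrable iM => //.
    by apply/measurable_EFinP; exact: continuous_measurable_fun.
  move=> y _; rewrite /= lee_fin (normrM M) (ger0_norm M0) indicE.
  case: (ltP `|y| B) => [yB|/gam0 ->]; last by rewrite normr0 mulr_ge0.
  by rewrite mem_set ?normr1 ?mulr1//; exact: Ey.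
exists gam, B, M; split => //.
have icosh := integrableZl measurableT (expR (- A)) integrable_cosh.
have iE' : integrable ((fun y => `|kap y - g y|) \_ E).
  have : mu.-integrable E (EFin \o (fun y => `|kap y - g y|)).
    have := integrable_abse (integrableB mE iE (ig n)).
    by apply: eq_integrable.
  move=> /(integrable_mkcond _ mE); apply: eq_integrable => // y _.
  by rewrite /= !patchE; case: ifP.
apply: (@le_trans _ _ (\int[mu]_y (((fun y => `|kap y - g y|) \_ E) y +
    expR (- A) * ((expR y + expR (- y)) * kap y)))).
  apply: le_Rintegral => //.
  - by apply: integrable_normB => //; exact: integrable_density.
  - exact: (integrableD measurableT iE' icosh).
  move=> y _; rewrite patchE mulrA.
  have ct0 : 0 <= expR (- A) * (expR y + expR (- y)).
    by rewrite mulr_ge0 ?expR_ge0// addr_ge0 ?expR_ge0.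
  have tail : A <= `|y| -> kap y <= expR (- A) * (expR y + expR (- y)) * kap y.
    by move=> /cosh_tail ct; rewrite ler_peMl.
  have ct1 := mulr_ge0 ct0 (k0 y).
  case: (leP `|y| A) => yA.
    have yE : y \in E by rewrite mem_set//; apply: Ey; rewrite /B; lra.
    by rewrite yE /gam chi1// mulr1 lerDl.
  have {}tail := tail (ltW yA).
  case: (ltP `|y| B) => [yB|By]; last first.
    rewrite gam0// subr0 (ger0_norm (k0 y)) (le_trans tail)// lerDr.
    by case: ifP.
  rewrite mem_set; last exact: Ey.
  have -> : kap y - gam y = chi y * (kap y - g y) + (1 - chi y) * kap y.
    by rewrite /gam; lra.
  have /andP[c0 c1] := chi01 y.
  apply: (le_trans (ler_normD _ _)); apply: lerD.
    by rewrite normrM (ger0_norm c0) ler_piMl.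
  apply: le_trans tail; rewrite ger0_norm ?mulr_ge0 ?subr_ge0//.
  by rewrite ler_piMl// lerBlDr lerDl.
rewrite RintegralD// (RintegralZl _ measurableT integrable_cosh) Rintegral_cosh.
rewrite [eps]splitr lerD// -Rintegral_mkcond.
rewrite /Rintegral -lee_fin fineK//.
rewrite integrable_fin_num//.
have := integrable_abse (integrableB mE iE (ig n)).
by apply: eq_integrable.
Unshelve. all: by end_near. Qed.

(** For a continuous function with compact support, the L^1 distance to its
    translate by [h] is a continuous function of [h] by dominated convergence;
    the general case follows by approximation. *)
Lemma L1_translation (eps : R) : 0 < eps -> exists2 delta : R, 0 < delta &
  forall h, `|h| <= delta -> \int[mu]_y `|kap (y + h) - kap y| <= eps.
Proof.
move=> e0; (* Two approximation errors and the translation of the continuous function. *)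
have e3 : 0 < eps / 3 by rewrite divr_gt0.
have [gam [B [S [cg gS gB ig ag]]]] := density_continuous_approx e3.
have igh h := integrable_translate h ig.
have ikh h := integrable_translate h integrable_density.
(* For |h| <= 1 both gam and its translate vanish outside [-C, C]. *)
pose C := B + 1.
have iS : integrable (fun y => 2 * S * \1_(`[- C, C]%classic : set R) y).
  have := integrableZl measurableT (2 * S) (integrable_indic_itv (- C) C true false).
  by apply: eq_integrable.
pose N h := \int[mu]_y `|gam (y + h) - gam y|.
have N0 : N 0 = 0.
  rewrite /N; under eq_Rintegral do rewrite addr0 subrr normr0.
  by rewrite Rintegral_cst// mul0r.
have cN : {for 0, continuous N}.
  apply: (@continuity_under_integral R _ _ mu (fun h y => `|gam (y + h) - gam y|)
    setT measurableT (- 1) 1 _ _ _ iS) => //.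
  - by move=> h _; exact: integrable_normB.
  - apply: aeW => y _ h _; apply: cvg_norm; apply: cvgB; last exact: cvg_cst.
    apply: (@continuous_comp _ _ _ (fun h => y + h) gam); last exact: cg.
    by apply: cvgD; [exact: cvg_cst|exact: cvg_id].
  - move=> h /=; rewrite in_itv/= => /andP[h1 h2]; apply: aeW => y _.
    rewrite normr_id indicE.
    have Sy := gS y; have Syh := gS (y + h).
    have S0 : 0 <= S by exact: le_trans (normr_ge0 _) Sy.
    case: (leP `|y| C) => yC.
      rewrite mem_set; last by rewrite /= in_itv/= -ler_norml.
      by rewrite mulr1 (le_trans (ler_normB _ _))//; lra.
    rewrite !gB ?subrr ?normr0 ?mulr_ge0//.
      by move: yC; rewrite /C; lra.
    have := ler_normB (y + h) h; rewrite addrK => yh.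
    have : `|h| <= 1 by rewrite ler_norml !ltW.
    by move: yC; rewrite /C; lra.
  - by rewrite inE/= in_itv/= ltrN10 ltr01.
have /cvgrPdist_le/(_ _ e3) := cN; rewrite N0.
move=> /nbhs_ballP[d /= d0 dN]; exists (d / 2); first by rewrite divr_gt0.
move=> h hd.
have Nh : N h <= eps / 3.
  have : ball 0 d h by rewrite /ball/= sub0r normrN; lra.
  by move/dN; rewrite sub0r normrN ger0_norm// /N Rintegral_ge0.
have i1 := integrable_normB (ikh h) (igh h).
have i2 := integrable_normB (igh h) ig.
have i3 := integrable_normB integrable_density ig.
apply: (@le_trans _ _ (\int[mu]_y ((`|kap (y + h) - gam (y + h)| +
   `|gam (y + h) - gam y|) + `|kap y - gam y|))).
  apply: le_Rintegral => //.
  - exact: integrable_normB (ikh h) integrable_density.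
  - exact: (integrableD measurableT (integrableD measurableT i1 i2) i3).
  move=> y _; rewrite (distrC (kap y)).
  have -> : kap (y + h) - kap y = (kap (y + h) - gam (y + h)) +
    (gam (y + h) - gam y) + (gam y - kap y) by lra.
  by rewrite (le_trans (ler_normD _ _))// lerD2r ler_normD.
rewrite (RintegralD measurableT (integrable_add i1 i2) i3) (RintegralD measurableT i1 i2).
rewrite (Rintegral_translate h i3).
by move: Nh ag; rewrite /N; lra.
Qed.

(** After reflecting the variable, the translation acts on the density and no
    regularity of [G] is used. *)
Lemma convolution_equicontinuous (eps : R) : 0 < eps -> exists2 delta : R, 0 < delta &
  forall G : R -> R, measurable_fun [set: R] G -> (forall y, `|G y| <= 1) ->
  forall x x', `|x - x'| <= delta ->
  `|\int[mu]_y (G (x - y) * kap y) - \int[mu]_y (G (x' - y) * kap y)| <= eps.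
Proof.
move=> e0; have [d d0 dP] := L1_translation e0; exists d => // G mG G1 x x' xx'.
have mGr z : measurable_fun [set: R] (fun y => G (z - y)).
  by apply: measurableT_comp => //; exact: measurable_funB.
have iGk z : integrable (fun y => G y * kap (z - y)).
  have := integrable_reflect z (integrable_bounded (mGr z) (fun y => G1 (z - y))).
  by apply: eq_integrable => // y _ /=; rewrite opprB addrCA subrr addr0.
have convE z : \int[mu]_y (G (z - y) * kap y) = \int[mu]_y (G y * kap (z - y)).
  rewrite -(Rintegral_reflect z (iGk z)); apply: eq_Rintegral => y _.
  by rewrite opprB addrCA subrr addr0.
rewrite !convE -RintegralB//.
apply: (le_trans (le_normr_Rintegral _ _)) => //.
  exact: (integrableB measurableT (iGk x) (iGk x')).
have iN := integrable_normB (integrable_translate (x' - x) integrable_density)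
  integrable_density.
have hd : `|x' - x| <= d by rewrite distrC.
rewrite (le_trans _ (dP _ hd))// -(Rintegral_reflect x iN); apply: le_Rintegral => //.
- exact: integrable_normB (iGk x) (iGk x').
- exact: (integrable_reflect x iN).
- move=> y _; have -> : x - y + (x' - x) = x' - y by lra.
  by rewrite -mulrBr normrM (distrC (kap _)) ler_piMl.
Qed.

(** If the average vanished, so would the average of the symmetrized integrand
    [K]; but [K y = 0] forces [kap y = 0] on both half-lines, and the density
    would vanish almost everywhere. *)
Lemma Rintegral_density_gt0 (G : R -> R) (M : R) : measurable_fun [set: R] G ->
  (forall y, 0 <= G y <= M) -> (forall y, 0 <= y -> 0 < G y) ->
  0 < \int[mu]_y (G y * kap y).
Proof.
move=> mG G0 Gp.
have GM y : `|G y| <= M by have /andP[? ?] := G0 y; rewrite ger0_norm.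
have iG := integrable_bounded mG GM.
pose K y := G y * kap y + G (0 - y) * kap (0 - y).
have Gge y : 0 <= G y by have /andP[] := G0 y.
have K0 y : 0 <= K y by rewrite addr_ge0// mulr_ge0.
rewrite lt_neqAle eq_sym Rintegral_ge0 ?andbT; last first.
  by move=> y _; rewrite mulr_ge0.
apply/eqP => I0.
have iK : integrable K := integrable_add iG (integrable_reflect 0 iG).
have mK : measurable_fun [set: R] (EFin \o K) := measurable_int mu iK.
have IK : (\int[mu]_y `|(EFin \o K) y| = 0)%E.
  transitivity (\int[mu]_y (K y)%:E)%E.
    by apply: eq_integral => y _; rewrite /= ger0_norm.
  rewrite -[LHS]fineK; last exact: (integrable_fin_num measurableT iK).
  rewrite -[fine _]/(\int[mu]_y K y) (RintegralD measurableT iG (integrable_reflect 0 iG)).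
  by rewrite (Rintegral_reflect 0 iG) I0 addr0.
have := (ae_eq_integral_abs mu measurableT mK).1 IK => aeK.
have aek : ae_eq mu setT (EFin \o kap) (cst 0%E).
  apply: filterS aeK => y /(_ Logic.I) [Ky] _.
  congr (_%:E); apply/eqP; move: Ky; rewrite /K sub0r ke => /eqP.
  rewrite paddr_eq0 ?mulr_ge0//.
  rewrite !mulf_eq0; case: (leP 0 y) => y0 /andP[].
    by rewrite (gt_eqF (Gp _ y0)).
  by rewrite (gt_eqF (Gp (- y) _)) ?oppr_ge0 ?ltW.
have : (\int[mu]_y (kap y)%:E = 0)%E.
  rewrite -[RHS](integral0 mu [set: R]); apply: ae_eq_integral => //.
  exact/measurable_EFinP.
by case: kd => _ _ _ -> _ [] /eqP; rewrite oner_eq0.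
Qed.

End Density.

(** * The characteristic equation *)

Section Speed.
Variables (R : realType) (d c : R) (kap : R -> R).
Hypothesis kd : even_density kap.
Hypothesis d0 : 0 < d.

Lemma supercritical_speed_gt0 (l : R) : 0 < l ->
  (1 + d) * mgf kap l < expR (l * c) -> 0 < c.
Proof.
move=> l0 h; rewrite -(pmulr_rgt0 _ l0) -expR_gt1 (le_lt_trans _ h)//.
have m1 := mgf_ge1 kd l; rewrite -[leLHS]mulr1 ler_pM//.
by rewrite lerDl ltW.
Qed.

(** The root is the supremum of the points of [[0, l0]] where the left side is at
    least [expR (l * c)]. Taking the last root gives the strict inequality just
    after it, on which the subsolution relies. *)
Lemma last_characteristic_root (l0 : R) : 0 < l0 ->
  (1 + d) * mgf kap l0 < expR (l0 * c) ->
  exists l, [/\ 0 < l < l0, (1 + d) * mgf kap l = expR (l * c) &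
    forall l', l < l' <= l0 -> (1 + d) * mgf kap l' < expR (l' * c)].
Proof.
move=> l00 hl0; pose h l := (1 + d) * mgf kap l - expR (l * c).
have ch : continuous h.
  move=> l; apply: cvgB.
    by apply: cvgMl_tmp; exact: mgf_continuous.
  apply: (@continuous_comp _ _ _ (fun l : R => l * c) expR); last exact: continuous_expR.
  by apply: cvgMr_tmp; exact: cvg_id.
have h0 : 0 < h 0.
  rewrite /h mul0r expR0 /mgf; under eq_Rintegral do rewrite mul0r expR0 mul1r.
  by rewrite (Rintegral_density kd) mulr1 addrC addKr.
pose S := [set l | 0 <= l <= l0 /\ 0 <= h l].
have S0 : S 0 by split; [rewrite lexx ltW|exact: ltW].
have Sub : ubound S l0 by move=> l [/andP[]].
have hS : has_sup S by split; [exists 0|exists l0].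
have hbS : has_ubound S by exists l0.
pose l := sup S.
have l_ge0 : 0 <= l by exact: ub_le_sup.
have l_le : l <= l0 by apply: ge_sup => //; exists 0.
have hl_ge : 0 <= h l.
  rewrite leNgt; apply/negP => hl.
  have : \forall t \near l, h t < 0 by exact: (cvgr_lt (h l) (ch l)).
  move=> /nbhs_ballP[e /= e0 eP].
  have [t [tl ht] lt] := sup_adherent e0 hS.
  have : h t < 0.
    apply: eP; rewrite /ball/= ger0_norm ?subr_ge0; last exact: ub_le_sup.
    by rewrite ltrBlDr -ltrBlDl -/l; move: lt; rewrite -/l; lra.
  by rewrite ltNge ht.
have l_lt : l < l0.
  rewrite lt_neqAle l_le andbT; apply/eqP => e.
  by move: hl_ge; rewrite e /h subr_ge0 leNgt hl0.
have hl_le : h l <= 0.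
  rewrite leNgt; apply/negP => hl.
  have : \forall t \near l, 0 < h t by exact: (cvgr_gt (h l) (ch l)).
  move=> /nbhs_ballP[e /= e0 eP].
  pose t := Num.min l0 (l + e / 2).
  have lt : l < t by rewrite lt_min l_lt ltrDl divr_gt0.
  have te : t <= l + e / 2 by rewrite ge_min lexx orbT.
  have St : S t.
    split; first by rewrite (le_trans l_ge0 (ltW lt)) ge_min lexx.
    apply/ltW/eP; rewrite /ball/= distrC gtr0_norm ?subr_gt0//.
    by move: te; lra.
  by have := ub_le_sup hbS St; rewrite leNgt lt.
have hl : h l = 0 by apply/eqP; rewrite eq_le hl_le hl_ge.
exists l; split.
- rewrite l_lt andbT lt_neqAle l_ge0 andbT eq_sym; apply/eqP => e.
  by move: h0; rewrite -[X in h X]e hl ltxx.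
- by apply/eqP; rewrite -subr_eq0 -/(h l) hl.
- move=> l' /andP[ll' l'l]; rewrite -subr_lt0 -/(h l') ltNge; apply/negP => hl'.
  have : S l' by split => //; rewrite l'l (le_trans l_ge0 (ltW ll')).
  by move/(ub_le_sup hbS); rewrite leNgt ll'.
Qed.

End Speed.

Lemma linear_speed_lt (R : realType) (d c : R) (k kap : R -> R) : 0 < d ->
  even_density kap ->
  (forall G : R -> R, measurable_fun [set: R] G -> (forall x, 0 <= G x) ->
    (\int[completed_lebesgue_measure]_y (G y * k y)%:E =
     \int[lebesgue_measure]_y (G y * kap y)%:E)%E) ->
  linear_speed d k < c ->
  exists2 l : R, 0 < l & (1 + d) * mgf kap l < expR (l * c).
Proof.
move=> d0 kd kE /inf_lt[|s [l l0 ->]].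
  by eexists; exists 1; first exact: ltr01.
have -> : \int[completed_lebesgue_measure]_y (expR (l * y) * k y) = mgf kap l.
  by congr fine; apply: kE; [exact: measurable_expMl|move=> x; exact: expR_ge0].
have m1 := mgf_ge1 kd l.
rewrite ltr_pdivrMr// (mulrC c) => h; exists l => //.
rewrite -[ltLHS]lnK; first by rewrite ltr_expR.
by rewrite posrE mulr_gt0//; lra.
Qed.

(** * The growth law *)

Section Growth.
Variables (R : realType) (d b a : R).
Hypothesis d0 : 0 < d.
Hypothesis b0 : 0 <= b.
Hypothesis a0 : 0 <= a.

Let d1 : 0 < 1 + d. Proof. by move: d0; lra. Qed.

Definition growth (u v r : R) : R := (1 + d) * u / (1 + d * (u + b * v + a * r)).

Lemma growth_den_ge1 (u v r : R) : 0 <= u -> 0 <= v -> 0 <= r ->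
  1 + d * u <= 1 + d * (u + b * v + a * r).
Proof.
move=> u0 v0 r0; rewrite lerD2l ler_pM2l// -addrA lerDl.
by rewrite addr_ge0// mulr_ge0.
Qed.

Lemma growth_den_gt0 (u v r : R) : 0 <= u -> 0 <= v -> 0 <= r ->
  1 <= 1 + d * (u + b * v + a * r).
Proof.
move=> u0 v0 r0; apply: le_trans (growth_den_ge1 u0 v0 r0).
by rewrite lerDl mulr_ge0// ltW.
Qed.

Lemma growth_bounds (u v r : R) : 0 <= u <= 1 -> 0 <= v -> 0 <= r ->
  0 <= growth u v r <= 1.
Proof.
move=> /andP[u0 u1] v0 r0; have h1 := growth_den_ge1 u0 v0 r0.
have h2 := growth_den_gt0 u0 v0 r0; rewrite /growth.
have hS := lt_le_trans ltr01 h2.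
rewrite divr_ge0 ?(mulr_ge0 (ltW d1)) ?(ltW hS)//= ler_pdivrMr// mul1r.
by apply: le_trans h1; rewrite mulrDl mul1r lerD2r.
Qed.

Lemma growth_gt0 (u v r : R) : 0 < u -> 0 <= v -> 0 <= r -> 0 < growth u v r.
Proof.
move=> u0 v0 r0; have h2 := growth_den_gt0 (ltW u0) v0 r0.
have hS := lt_le_trans ltr01 h2.
by rewrite /growth divr_gt0// mulr_gt0.
Qed.

Lemma growth_lt1 (u v r : R) : 0 <= u -> u < 1 -> 0 <= v -> 0 <= r -> growth u v r < 1.
Proof.
move=> u0 u1 v0 r0; have h1 := growth_den_ge1 u0 v0 r0.
have h2 := growth_den_gt0 u0 v0 r0; rewrite /growth.
have hS := lt_le_trans ltr01 h2.
rewrite ltr_pdivrMr// mul1r.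
by apply: lt_le_trans h1; rewrite mulrDl mul1r ltrD2r.
Qed.

Lemma growth_le_linear (u v r : R) : 0 <= u -> 0 <= v -> 0 <= r ->
  growth u v r <= (1 + d) * u.
Proof.
move=> u0 v0 r0; have h2 := growth_den_gt0 u0 v0 r0; rewrite /growth.
have hS := lt_le_trans ltr01 h2.
by rewrite ler_pdivrMr// ler_peMr// mulr_ge0// ltW.
Qed.

(** This is [1 / (1 + t) >= 1 - t]. *)
Lemma growth_ge_quadratic (u v r : R) : 0 <= u -> 0 <= v -> 0 <= r ->
  (1 + d) * (u - d * (u * (u + b * v + a * r))) <= growth u v r.
Proof.
move=> u0 v0 r0; have h2 := growth_den_gt0 u0 v0 r0; rewrite /growth.
move: h2; set w := u + b * v + a * r => h2.
have hS := lt_le_trans ltr01 h2.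
rewrite -[leRHS]mulrA ler_pM2l// ler_pdivlMr//.
have -> : (u - d * (u * w)) * (1 + d * w) = u - u * (d * w) ^+ 2 by ring.
by rewrite gerBl mulr_ge0// sqr_ge0.
Qed.

Lemma growth_lipschitz (u v r u' v' r' e : R) :
  0 <= u <= 1 -> 0 <= v <= 1 -> 0 <= r <= 1 ->
  0 <= u' <= 1 -> 0 <= v' <= 1 -> 0 <= r' <= 1 ->
  `|u - u'| <= e -> `|v - v'| <= e -> `|r - r'| <= e ->
  `|growth u v r - growth u' v' r'| <= (1 + d) * (1 + 2 * d * (b + a)) * e.
Proof.
move=> /andP[u0 u1] /andP[v0 v1] /andP[r0 r1] /andP[u'0 u'1] /andP[v'0 v'1].
move=> /andP[r'0 r'1] uu' vv' rr'.
have e0 : 0 <= e by exact: le_trans (normr_ge0 _) uu'.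
pose C := 1 + 2 * d * (b + a); rewrite -/C.
have C0 : 0 <= C by rewrite addr_ge0// !mulr_ge0 ?addr_ge0 ?(ltW d0).
have h := growth_den_gt0 u0 v0 r0; have h' := growth_den_gt0 u'0 v'0 r'0.
rewrite /growth; move: h h'; set S := 1 + d * (u + _ + _).
set S' := 1 + d * (u' + _ + _) => h h'.
have S0 : 0 < S by lra.
have S'0 : 0 < S' by lra.
have -> : (1 + d) * u / S - (1 + d) * u' / S' =
  (1 + d) * ((u - u') + d * (b * (u * v' - u' * v) + a * (u * r' - u' * r))) / (S * S').
  have S0' : S != 0 by rewrite gt_eqF.
  have S'0' : S' != 0 by rewrite gt_eqF.
  have -> : (u - u') + d * (b * (u * v' - u' * v) + a * (u * r' - u' * r)) = u * S' - u' * S.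
    by rewrite /S /S'; ring.
  by field; rewrite S0' S'0'.
have prod x y x' y' : 0 <= x <= 1 -> 0 <= y' <= 1 -> 0 <= x' <= 1 -> 0 <= y <= 1 ->
    `|x - x'| <= e -> `|y - y'| <= e -> `|x * y' - x' * y| <= 2 * e.
  move=> /andP[x0 x1] /andP[y'0 y'1] /andP[x'0 x'1] /andP[y0 y1] xx' yy'.
  have -> : x * y' - x' * y = (x - x') * y' - x' * (y - y') by ring.
  apply: (le_trans (ler_normB _ _)); rewrite !normrM (ger0_norm y'0) (ger0_norm x'0).
  have : `|x - x'| * y' <= e * 1 by exact: ler_pM.
  have : x' * `|y - y'| <= 1 * e by exact: ler_pM.
  lra.
have pv := prod u v u' v'; have pr := prod u r u' r'.
rewrite u0 u1 v0 v1 u'0 u'1 v'0 v'1 r0 r1 r'0 r'1 in pv pr.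
have {}pv := pv isT isT isT isT uu' vv'; have {}pr := pr isT isT isT isT uu' rr'.
have SS : 1 <= S * S' by rewrite -[1]mulr1 ler_pM.
have SS0 := lt_le_trans ltr01 SS.
rewrite normrM normfV (gtr0_norm SS0) ler_pdivrMr// normrM (gtr0_norm d1) -!mulrA ler_pM2l//.
apply: (@le_trans _ _ (C * e)); last by rewrite mulrA ler_peMr// mulr_ge0.
apply: (le_trans (ler_normD _ _)).
have -> : C * e = e + d * (b * (2 * e) + a * (2 * e)) by rewrite /C; ring.
apply: lerD => //; rewrite normrM (gtr0_norm d0) ler_pM2l//.
apply: (le_trans (ler_normD _ _)); rewrite !normrM (ger0_norm b0) (ger0_norm a0).
by apply: lerD; rewrite ler_wpM2l.
Qed.

End Growth.

(** * The wave operator between its super- and subsolution *)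

Section ExpConvolution.
Variables (R : realType) (kap : R -> R).
Hypothesis kd : even_density kap.
Notation mu := (@lebesgue_measure R).
Notation integrable f := (mu.-integrable [set: R] (EFin \o f)).

Let expE (l z y : R) : expR (l * (z - y)) * kap y =
  expR (l * z) * (expR (- l * y) * kap y).
Proof. by rewrite mulrBr expRD mulNr mulrA. Qed.

Lemma integrable_exp_conv (l z : R) : integrable (fun y => expR (l * (z - y)) * kap y).
Proof.
have := integrableZl measurableT (expR (l * z)) (integrable_exp kd (- l)).
by apply: eq_integrable => // y _; rewrite /= expE.
Qed.

Lemma Rintegral_exp_conv (l z : R) :
  \int[mu]_y (expR (l * (z - y)) * kap y) = expR (l * z) * mgf kap l.
Proof.
under eq_Rintegral do rewrite expE.
by rewrite (RintegralZl _ measurableT (integrable_exp kd (- l))) -/(mgf _ _) mgfN.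
Qed.

End ExpConvolution.

Section Wave.
Variables (R : realType) (d b a : bool -> R) (kap : bool -> R -> R).
Variables (c eps q : R) (lam : bool -> R).
Notation mu := (@lebesgue_measure R).
Notation integrable f := (mu.-integrable [set: R] (EFin \o f)).
Hypothesis d0 : forall i, 0 < d i.
Hypothesis b0 : forall i, 0 <= b i.
Hypothesis a0 : forall i, 0 <= a i.
Hypothesis kd : forall i, even_density (kap i).
Hypothesis c0 : 0 < c.
Hypothesis eps0 : 0 < eps.
Hypothesis eps_lam : forall i, eps <= lam i.
Hypothesis q1 : 1 <= q.
Hypothesis lam_root : forall i, (1 + d i) * mgf (kap i) (lam i) = expR (lam i * c).
Hypothesis lam_sub : forall i,
  (q + d i * (1 + b i + a i)) * ((1 + d i) * mgf (kap i) (lam i + eps)) <=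
  q * expR ((lam i + eps) * c).

(** [true] and [false] index the two species, and [negb] exchanges them. *)
Definition wave_up (i : bool) (x : R) : R := Num.min 1 (expR (lam i * x)).

Definition wave_lo (i : bool) (x : R) : R :=
  Num.max 0 (expR (lam i * x) - q * expR ((lam i + eps) * x)).

Definition reaction (U : bool -> R -> R) (i : bool) (s : R) : R :=
  growth (d i) (b i) (a i) (U i s) (U i (s - c)) (U (~~ i) s).

Definition wave_map (U : bool -> R -> R) (i : bool) (x : R) : R :=
  \int[mu]_y (reaction U i (x - c - y) * kap i y).

Let k0 i y : 0 <= kap i y. Proof. by case: (kd i). Qed.
Let lam0 i : 0 < lam i. Proof. exact: lt_le_trans eps0 (eps_lam i). Qed.
Let d1 i : 0 < 1 + d i. Proof. by have := d0 i; lra. Qed.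

Lemma measurable_wave_up i : measurable_fun [set: R] (wave_up i).
Proof. by apply: measurable_minr => //; exact: measurable_expMl. Qed.

Lemma measurable_wave_lo i : measurable_fun [set: R] (wave_lo i).
Proof.
apply: measurable_maxr => //; apply: measurable_funB; first exact: measurable_expMl.
by apply: measurable_funM => //; exact: measurable_expMl.
Qed.

Lemma wave_lo_ge0 i x : 0 <= wave_lo i x.
Proof. by rewrite /wave_lo le_max lexx. Qed.

Lemma wave_up_le1 i x : wave_up i x <= 1.
Proof. by rewrite /wave_up ge_min lexx. Qed.

Lemma wave_lo_up i x : wave_lo i x <= wave_up i x.
Proof.
have q0 : 0 <= q by have := q1; lra.
have e0 := expR_ge0 (lam i * x); have e1 := expR_ge0 ((lam i + eps) * x).
rewrite /wave_lo /wave_up ge_max le_min ler01 e0/=.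
rewrite le_min gerBl mulr_ge0// andbT.
case: (leP 0 x) => x0.
  apply: (@le_trans _ _ 0) => //; rewrite subr_le0.
  apply: (@le_trans _ _ (expR ((lam i + eps) * x))); last by rewrite ler_peMl.
  by rewrite ler_expR ler_wpM2r// lerDl ltW.
apply: (@le_trans _ _ (expR (lam i * x))); first by rewrite gerBl mulr_ge0.
by rewrite expR_le1 pmulr_rle0// ltW.
Qed.

Local Notation in_wave_band := (in_band wave_lo wave_up).

Lemma band_01 U i x : in_wave_band U -> 0 <= U i x <= 1.
Proof.
move=> [_ /(_ i x) /andP[h1 h2]].
by rewrite (le_trans (wave_lo_ge0 i x) h1) (le_trans h2 (wave_up_le1 i x)).
Qed.

Lemma band_ge0 U i x : in_wave_band U -> 0 <= U i x.
Proof. by move=> Ub; have /andP[] := band_01 i x Ub. Qed.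

Lemma band_le_exp U i x : in_wave_band U -> U i x <= expR (lam i * x).
Proof. by move=> [_ /(_ i x) /andP[_]]; rewrite /wave_up le_min => /andP[]. Qed.

(** The factor [e^(eps x)] bounds all densities at once because
    [eps <= lam i]; it measures the smallness of the competition at [-oo]. *)
Lemma band_le_exp_eps U i x : in_wave_band U -> U i x <= expR (eps * x).
Proof.
move=> Ub; case: (leP 0 x) => x0.
  have /andP[_ h] := band_01 i x Ub; rewrite (le_trans h)//.
  by rewrite -expR0 ler_expR mulr_ge0// ltW.
rewrite (le_trans (band_le_exp i x Ub))// ler_expR.
by rewrite ler_nM2r.
Qed.

Lemma band_ge_exp U i x : in_wave_band U ->
  expR (lam i * x) - q * expR ((lam i + eps) * x) <= U i x.
Proof. by move=> [_ /(_ i x) /andP[+ _]]; rewrite /wave_lo ge_max => /andP[]. Qed.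

Lemma reaction_01 U i s : in_wave_band U -> 0 <= reaction U i s <= 1.
Proof. by move=> Ub; apply: growth_bounds => //; [exact: band_01|exact: band_ge0..]. Qed.

Lemma measurable_reaction U i : in_wave_band U -> measurable_fun [set: R] (reaction U i).
Proof.
move=> [mU Ub].
have mshift : measurable_fun [set: R] (fun s => U i (s - c)).
  by apply: measurableT_comp => //; exact: measurable_funB.
have mden : measurable_fun [set: R]
   (fun s => 1 + d i * (U i s + b i * U i (s - c) + a i * U (~~ i) s)).
  apply: measurable_funD => //; apply: measurable_funM => //.
  apply: measurable_funD; last exact: measurable_funM.
  by apply: measurable_funD => //; exact: measurable_funM.
apply: measurable_funM; first exact: measurable_funM.
have -> : (fun s => (1 + d i * (U i s + b i * U i (s - c) + a i * U (~~ i) s))^-1) =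
  (fun t : R => (Num.max 1 t)^-1) \o
  (fun s => 1 + d i * (U i s + b i * U i (s - c) + a i * U (~~ i) s)).
  apply/funext => s /=; congr (_^-1); apply/esym/max_idPr.
  by apply: growth_den_gt0 => //; exact: (band_ge0 _ _ (conj mU Ub)).
apply: measurableT_comp => //; apply: nonincreasing_measurable => //.
move=> x y xy; rewrite lef_pV2 ?posrE ?lt_max ?ltr01//.
by rewrite ge_max !le_max lexx xy !orbT.
Qed.

Lemma integrable_reaction U i x : in_wave_band U ->
  integrable (fun y => reaction U i (x - y) * kap i y).
Proof.
move=> Ub; apply: (integrable_bounded (kd i) (M := 1)).
  apply: (measurableT_comp (measurable_reaction i Ub)); exact: measurable_funB.
by move=> y; have /andP[r0 r1] := reaction_01 i (x - y) Ub; rewrite ger0_norm.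
Qed.

(** The growth law lies below its linearization, for which [e^(lam_i x)] is an
    exact solution. *)
Lemma wave_map_le_up U i x : in_wave_band U -> wave_map U i x <= wave_up i x.
Proof.
move=> Ub; rewrite /wave_up le_min; apply/andP; split.
  rewrite -(Rintegral_density (kd i)); apply: le_Rintegral => //.
  - exact: integrable_reaction.
  - exact: integrable_density.
  - by move=> y _; rewrite ler_piMl//; have /andP[] := reaction_01 i (x - c - y) Ub.
apply: (@le_trans _ _ (\int[mu]_y ((1 + d i) * (expR (lam i * (x - c - y)) * kap i y)))).
  apply: le_Rintegral => //.
  - exact: integrable_reaction.
  - exact: (integrableZl measurableT (1 + d i) (integrable_exp_conv (kd i) _ _)).
  - move=> y _; rewrite mulrA ler_wpM2r//.
    apply: (@le_trans _ _ ((1 + d i) * U i (x - c - y))).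
      by apply: growth_le_linear => //; exact: band_ge0.
    by rewrite ler_pM2l//; exact: band_le_exp.
rewrite (RintegralZl _ measurableT (integrable_exp_conv (kd i) _ _)).
rewrite (Rintegral_exp_conv (kd i)) mulrCA lam_root -expRD -mulrDr subrK//.
Qed.

(** The quadratic loss is at most [d_i (1 + b_i + a_i) e^(lam_i s) e^(eps s)]: one
    factor is bounded by the supersolution, the other by [band_le_exp_eps]. *)
Lemma reaction_ge U i s : in_wave_band U ->
  (1 + d i) * expR (lam i * s) -
  (1 + d i) * (q + d i * (1 + b i + a i)) * expR ((lam i + eps) * s) <= reaction U i s.
Proof.
move=> Ub; have u0 := band_ge0 i s Ub; have v0 := band_ge0 i (s - c) Ub.
have r0 := band_ge0 (~~ i) s Ub.
apply: le_trans (growth_ge_quadratic (d0 i) (b0 i) (a0 i) u0 v0 r0).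
rewrite -mulrA -mulrBr ler_pM2l//.
have ue := band_le_exp i s Ub; have ge := band_ge_exp i s Ub.
have ve : U i (s - c) <= expR (eps * s).
  apply: (le_trans (band_le_exp_eps i (s - c) Ub)).
  by rewrite ler_expR ler_pM2l// gerBl ltW.
have uq : U i s * (U i s + b i * U i (s - c) + a i * U (~~ i) s) <=
    expR (lam i * s) * ((1 + b i + a i) * expR (eps * s)).
  apply: ler_pM => //; first by rewrite !addr_ge0 ?mulr_ge0.
  rewrite !mulrDl mul1r; apply: lerD; last by rewrite ler_wpM2l//; exact: band_le_exp_eps.
  by apply: lerD; [exact: band_le_exp_eps|rewrite ler_wpM2l].
have dq := ler_wpM2l (ltW (d0 i)) uq.
move: ge dq; rewrite !(mulrDl (lam i)) expRD; move: (U i s * _) => w.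
move: (expR (lam i * s)) (expR (eps * s)) => E1 E2 ge dq.
have -> : E1 - (q + d i * (1 + b i + a i)) * (E1 * E2) =
  (E1 - q * (E1 * E2)) - d i * (E1 * ((1 + b i + a i) * E2)) by ring.
exact: lerB.
Qed.

(** The first exponential is reproduced exactly; the second one is contracted,
    and [lam_sub] says that the contraction outweighs the quadratic loss. *)
Lemma wave_map_ge_lo U i x : in_wave_band U -> wave_lo i x <= wave_map U i x.
Proof.
move=> Ub; rewrite /wave_lo ge_max; apply/andP; split.
  apply: Rintegral_ge0 => y _; rewrite mulr_ge0//.
  by have /andP[] := reaction_01 i (x - c - y) Ub.
set C := (1 + d i) * (q + d i * (1 + b i + a i)).
have i1 := integrableZl measurableT (1 + d i) (integrable_exp_conv (kd i) (lam i) (x - c)).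
have i2 := integrableZl measurableT C (integrable_exp_conv (kd i) (lam i + eps) (x - c)).
apply: (@le_trans _ _ (\int[mu]_y ((1 + d i) * (expR (lam i * (x - c - y)) * kap i y) -
    C * (expR ((lam i + eps) * (x - c - y)) * kap i y)))); last first.
  apply: le_Rintegral => //.
  - exact: (integrableB measurableT i1 i2).
  - exact: integrable_reaction.
  - by move=> y _; rewrite !mulrA -mulrBl ler_wpM2r//; exact: reaction_ge.
rewrite (RintegralB measurableT i1 i2).
rewrite !(RintegralZl _ measurableT (integrable_exp_conv (kd i) _ _)).
rewrite !(Rintegral_exp_conv (kd i)) mulrCA lam_root -expRD -mulrDr subrK lerD2l lerN2.
have -> : C * (expR ((lam i + eps) * (x - c)) * mgf (kap i) (lam i + eps)) =
  ((q + d i * (1 + b i + a i)) * ((1 + d i) * mgf (kap i) (lam i + eps))) *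
   expR ((lam i + eps) * (x - c)) by rewrite /C; ring.
have h := expR_ge0 ((lam i + eps) * (x - c)).
apply: (le_trans (ler_wpM2r h (lam_sub i))).
by rewrite -mulrA -expRD -mulrDr (addrC c) subrK.
Qed.

Lemma wave_map_band U : in_wave_band U ->
  forall i x, wave_lo i x <= wave_map U i x <= wave_up i x.
Proof. by move=> Ub i x; rewrite wave_map_ge_lo// wave_map_le_up. Qed.

Lemma wave_map_equicont (e : R) : 0 < e -> exists2 delta : R, 0 < delta &
  forall U, in_wave_band U -> forall i x y, `|x - y| <= delta ->
    `|wave_map U i x - wave_map U i y| <= e.
Proof.
move=> e0.
have /choice[D DP] : forall i : bool, exists D, 0 < D /\
    forall U, in_wave_band U -> forall x y, `|x - y| <= D ->
    `|wave_map U i x - wave_map U i y| <= e.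
  move=> i; have [D D0 DP] := convolution_equicontinuous (kd i) e0.
  exists D; split=> // U Ub x y xy; apply: DP.
  - exact: measurable_reaction.
  - by move=> s; have /andP[r0 r1] := reaction_01 i s Ub; rewrite ger0_norm.
  - by have -> : x - c - (y - c) = x - y by ring.
have [delta delta0 dD] := finite_lower_bound (fun i => (DP i).1).
exists delta => // U Ub i x y xy; apply: (DP i).2 => //.
exact: le_trans xy (dD i).
Qed.

(** On bounded sets the Lipschitz bound of the growth law applies; outside, the
    integrands differ by at most 1, which [cosh_tail] makes negligible. *)
Lemma wave_map_cont i x (e : R) : 0 < e -> exists A delta : R, 0 < delta /\
  forall U V, in_wave_band U -> in_wave_band V ->
    (forall j s, `|s| <= A -> `|U j s - V j s| <= delta) ->
    `|wave_map U i x - wave_map V i x| <= e.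
Proof.
move=> e0; have e2 : 0 < e / 2 by rewrite divr_gt0.
have m0 : 0 <= 2 * mgf (kap i) 1 by have := mgf_ge1 (kd i) 1; lra.
have [A A0 hA] := exp_small m0 e2.
pose C := (1 + d i) * (1 + 2 * d i * (b i + a i)).
have C0 : 0 < C.
  by rewrite mulr_gt0// ltr_wpDr// !mulr_ge0 ?addr_ge0// ltW.
exists (`|x - c| + A + c), (e / 2 / C); split; first by rewrite divr_gt0.
move=> U V Ub Vb UV.
have mr W : in_wave_band W -> measurable_fun [set: R] (fun y => reaction W i (x - c - y)).
  by move=> Wb; apply: (measurableT_comp (measurable_reaction i Wb)); exact: measurable_funB.
have r1 W y : in_wave_band W -> `|reaction W i (x - c - y)| <= 1.
  by move=> Wb; have /andP[r0 r1] := reaction_01 i (x - c - y) Wb; rewrite ger0_norm.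
have far y : A <= `|y| -> 1 <= expR (- A) * (expR y + expR (- y)) by exact: cosh_tail.
have := Rintegral_dist (kd i) (delta := e / 2) (eta := expR (- A)) (mr _ Ub) (mr _ Vb)
  (fun y => r1 U y Ub) (fun y => r1 V y Vb).
move=> H; apply: (le_trans (H _)); last first.
  by rewrite [leRHS]splitr lerD2l.
move=> y; have cosh0 : 0 <= expR (- A) * (expR y + expR (- y)).
  by rewrite mulr_ge0 ?expR_ge0// addr_ge0 ?expR_ge0.
case: (leP `|y| A) => yA; last first.
  have := far y (ltW yA).
  have /andP[u0 u1] := reaction_01 i (x - c - y) Ub.
  have /andP[v0 v1] := reaction_01 i (x - c - y) Vb.
  by move: e2; rewrite ler_norml; lra.
apply: (@le_trans _ _ (e / 2)); last by rewrite lerDl.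
have s1 : `|x - c - y| <= `|x - c| + A + c.
  by have := ler_normB (x - c) y; have := c0; lra.
have s2 : `|x - c - y - c| <= `|x - c| + A + c.
  have := ler_normB (x - c - y) c; have := ler_normB (x - c) y; rewrite (gtr0_norm c0); lra.
have -> : e / 2 = C * (e / 2 / C) by rewrite mulrCA divff ?mulr1// gt_eqF.
by apply: growth_lipschitz => //; first [exact: band_01|exact: UV].
Qed.

(** The subsolution is positive where [q e^(eps x) < 1], and then [x < 0] because
    [q >= 1]. *)
Lemma wave_lo_far : exists x0 : R, forall i x, x <= x0 -> 0 < wave_lo i x /\ wave_up i x < 1.
Proof.
have q0 : 0 < q by exact: lt_le_trans ltr01 q1.
have lnq : 0 <= ln q by rewrite ln_ge0.
exists (- ((ln q + 1) / eps)) => i x xle.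
have x0 : x < 0.
  by rewrite (le_lt_trans xle)// oppr_lt0 divr_gt0// ltr_wpDl.
have ex : eps * x < - ln q.
  apply: (@le_lt_trans _ _ (- (ln q + 1))).
    by move: xle; rewrite lerNr -[_ / eps]mulrC -ler_pdivlMl ?invr_gt0// invrK mulrN lerNr.
  lra.
split.
  rewrite /wave_lo lt_max; apply/orP; right.
  rewrite mulrDl expRD mulrCA -[X in X - _]mulr1 -mulrBr mulr_gt0 ?expR_gt0// subr_gt0.
  by rewrite -[q]lnK ?posrE// -expRD expR_lt1 -ltrBrDl sub0r.
by rewrite /wave_up gt_min; apply/orP; right; rewrite expR_lt1 pmulr_rlt0.
Qed.

Theorem exists_wave : exists U : bool -> R -> R,
  [/\ in_wave_band U, wave_map U = U & forall i x, 0 < U i x < 1].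
Proof.
have [U Ub UE] := band_fixed_point measurable_wave_lo measurable_wave_up wave_lo_ge0
  wave_lo_up wave_up_le1 wave_map_band wave_map_equicont wave_map_cont.
exists U; split => // i x.
have [x0 x0P] := wave_lo_far.
(* The value at x only averages values at points x - c - y; those with y >= 0 are
   covered by the induction hypothesis. *)
suff H : forall n : nat, forall i x, x <= x0 + n%:R * c -> 0 < U i x < 1.
  apply: (H (Num.truncn `|(x - x0) / c|).+1).
  rewrite -lerBlDl -ler_pdivrMr//.
  by apply: (le_trans (ler_norm _)); apply: ltW; exact: truncnS_gt.
elim=> [|n IH] j y.
  rewrite mul0r addr0 => /(x0P j)[l0 u1].
  by have [_ /(_ j y) /andP[h1 h2]] := Ub; rewrite (lt_le_trans l0 h1) (le_lt_trans h2 u1).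
rewrite -natr1 mulrDl mul1r => yle.
have s_le z : 0 <= z -> 0 < U j (y - c - z) < 1.
  by move=> z0; apply: IH; move: yle z0; lra.
have mr := measurableT_comp (measurable_reaction j Ub)
  (measurable_funB (measurable_cst (y - c)) (@measurable_id _ _ setT)).
have r01 z := reaction_01 j (y - c - z) Ub.
rewrite -UE; apply/andP; split.
  apply: (Rintegral_density_gt0 (kd j) mr r01) => z /s_le /andP[u0 _].
  by apply: growth_gt0 => //; exact: band_ge0.
rewrite -subr_gt0 -(Rintegral_density (kd j)).
rewrite -(RintegralB measurableT (integrable_density (kd j)) (integrable_reaction j (y - c) Ub)).
have -> : \int[mu]_z (kap j z - reaction U j (y - c - z) * kap j z) =
          \int[mu]_z ((1 - reaction U j (y - c - z)) * kap j z).
  by apply: eq_Rintegral => z _; rewrite mulrBl mul1r.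
apply: (Rintegral_density_gt0 (kd j) (M := 1)).
- exact: measurable_funB.
- by move=> z; have /andP[r0 r1] := r01 z; rewrite subr_ge0 r1 gerBl.
- move=> z /s_le /andP[u0 u1]; rewrite subr_gt0.
  by apply: growth_lt1 => //; [exact: ltW|exact: band_ge0..].
Qed.

End Wave.

(** * Existence of the waves *)

Lemma bounded_unif_continuous_pair (R : realType) (u v : R -> R) :
  (forall x, 0 < u x < 1 /\ 0 < v x < 1) ->
  (forall e : R, 0 < e -> exists2 delta : R, 0 < delta & forall x y, `|x - y| <= delta ->
    `|u x - u y| <= e /\ `|v x - v y| <= e) ->
  bounded_unif_continuous (fun x => (u x, v x)).
Proof.
move=> uv01 uvc; split.
  exists 1; split; first exact: num_real.
  move=> M M1 x _; have [/andP[u0 u1] /andP[v0 v1]] := uv01 x.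
  rewrite /= prod_normE/= ge_max (gtr0_norm u0) (gtr0_norm v0); apply/andP; split; lra.
apply/unif_continuousP => e e0; have e2 : 0 < e / 2 by rewrite divr_gt0.
have [delta delta0 dP] := uvc _ e2; exists delta => // -[x y] /= xy.
have [ux vx] := dP x y (ltW xy).
by split; rewrite /ball/=; lra.
Qed.

(** [eps] keeps [lam i + eps] in the range where the characteristic inequality is
    strict, and the gap there allows a factor [q] common to both species. *)
Lemma linear_parameters (R : realType) (d b a : bool -> R) (kap : bool -> R -> R) (c : R) :
  (forall i, 0 < d i) -> (forall i, 0 <= b i) -> (forall i, 0 <= a i) ->
  (forall i, even_density (kap i)) ->
  (forall i, exists2 l : R, 0 < l & (1 + d i) * mgf (kap i) l < expR (l * c)) ->
  exists lam : bool -> R, exists eps q : R,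
  [/\ 0 < eps, forall i, eps <= lam i, 1 <= q,
      forall i, (1 + d i) * mgf (kap i) (lam i) = expR (lam i * c) &
      forall i, (q + d i * (1 + b i + a i)) * ((1 + d i) * mgf (kap i) (lam i + eps)) <=
        q * expR ((lam i + eps) * c)].
Proof.
move=> d0 b0 a0 kd super.
have /choice[l0 l0P] : forall i, exists l0, 0 < l0 /\
    (1 + d i) * mgf (kap i) l0 < expR (l0 * c).
  by move=> i; have [l ? ?] := super i; exists l.
have /choice[lam lamP] := fun i => last_characteristic_root (kd i) (d0 i) (l0P i).1 (l0P i).2.
have [eps eps0 epsP] : exists2 eps, 0 < eps & forall i, eps <= Num.min (lam i) (l0 i - lam i).
  apply: finite_lower_bound => i; have [/andP[h1 h2] _ _] := lamP i.
  by rewrite lt_min h1 subr_gt0.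
pose m i := (1 + d i) * mgf (kap i) (lam i + eps).
pose X i := expR ((lam i + eps) * c).
have mX i : m i < X i.
  have [_ _ h] := lamP i; apply: h; rewrite ltrDl eps0/= addrC -lerBrDr.
  by have := epsP i; rewrite le_min => /andP[].
pose K i := d i * (1 + b i + a i).
have m0 i : 0 <= m i.
  by rewrite mulr_ge0//; [have := d0 i; lra|exact: le_trans ler01 (mgf_ge1 (kd i) _)].
have K0 i : 0 <= K i by rewrite mulr_ge0 ?addr_ge0// ltW.
(* Solving the required inequality (q + K) m <= q X for q. *)
pose Q i := K i * m i / (X i - m i).
have Q0 i : 0 <= Q i.
  by apply: divr_ge0; [exact: mulr_ge0|rewrite subr_ge0 ltW].
exists lam, eps, (1 + (Q true + Q false)); split => //.
- by move=> i; have := epsP i; rewrite le_min => /andP[].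
- by rewrite lerDl addr_ge0.
- by move=> i; have [] := lamP i.
- move=> i; rewrite -/(m i) -/(X i) -/(K i).
  have Qi : Q i <= 1 + (Q true + Q false).
    by have := Q0 true; have := Q0 false; case: i; lra.
  have mXi : 0 < X i - m i by rewrite subr_gt0.
  move: Qi; rewrite /Q ler_pdivrMr//; lra.
Qed.

Unset Implicit Arguments.
Set Strict Implicit.
Set Printing Implicit Defensive.

Theorem theorem5p7 (R : realType) (a1 a2 b1 b2 d1 d2 : R) (k1 k2 : R -> R)
  (ha1 : 0 <= a1) (ha2 : 0 <= a2) (hb1 : 0 <= b1) (hb2 : 0 <= b2)
  (hd1 : 0 < d1) (hd2 : 0 < d2)
  (hba1 : a2 < 1 + b1) (hba2 : a1 < 1 + b2)
  (hk1 : dispersal_kernel k1) (hk2 : dispersal_kernel k2)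
  (c : R) (hc : c_star d1 d2 k1 k2 < c) :
  exists rho varrho : R -> R,
    [/\ bounded_unif_continuous (fun xi => (rho xi, varrho xi)),
        wave_equation c d1 b1 a1 k1 rho varrho,
        wave_equation c d2 b2 a2 k2 varrho rho
      & forall xi : R, 0 < rho xi < 1 /\ 0 < varrho xi < 1].
Proof.
pose d i := if i then d1 else d2; pose b i := if i then b1 else b2.
pose a i := if i then a1 else a2; pose k i := if i then k1 else k2.
have d0 i : 0 < d i by case: i.
have b0 i : 0 <= b i by case: i.
have a0 i : 0 <= a i by case: i.
have dk i : dispersal_kernel (k i) by case: i.
have /choice[kap kapP] : forall i, exists kap, even_density kap /\
    forall G : R -> R, measurable_fun [set: R] G -> (forall x, 0 <= G x) ->
    (\int[completed_lebesgue_measure]_y (G y * k i y)%:E =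
     \int[lebesgue_measure]_y (G y * kap y)%:E)%E.
  by move=> i; have [kap ? ?] := kernel_density (dk i); exists kap.
have kd i := (kapP i).1; have kE i := (kapP i).2.
have super i : exists2 l, 0 < l & (1 + d i) * mgf (kap i) l < expR (l * c).
  apply: (linear_speed_lt (d0 i) (kd i) (kE i)).
  have [hc1 hc2] : linear_speed d1 k1 < c /\ linear_speed d2 k2 < c.
    by apply/andP; rewrite -gt_max.
  by case: i; [exact: hc1|exact: hc2].
have c0 : 0 < c.
  by have [l l0 h] := super true; exact: (supercritical_speed_gt0 (kd true) (d0 true) l0 h).
have [lam [eps [q [eps0 el q1 root sub]]]] := linear_parameters d0 b0 a0 kd super.
have [U [Ub UE U01]] := exists_wave d0 b0 a0 kd c0 eps0 el q1 root sub.
have eqU i : wave_equation c (d i) (b i) (a i) (k i) (U i) (U (~~ i)).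
  move=> xi; rewrite -[LHS]/(U i (xi + c)) -[in LHS]UE /wave_map addrK.
  congr fine; apply/esym/(kE i (fun y => reaction d b a c U i (xi - y))).
    apply: (measurableT_comp (measurable_reaction c d0 b0 a0 i Ub)).
    exact: measurable_funB.
  by move=> y; have /andP[] := reaction_01 c d0 b0 a0 i (xi - y) Ub.
exists (U true), (U false); split.
- apply: bounded_unif_continuous_pair => [x|e e0]; first by split; exact: U01.
  have [delta delta0 dP] := wave_map_equicont c eps q lam d0 b0 a0 kd e0.
  exists delta => // x y xy; rewrite -UE; split; exact: dP.
- exact: (eqU true).
- exact: (eqU false).
- by move=> xi; split; exact: U01.
Qed.
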